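(* Let $G$ be a finite simple connected graph with $c(G)\ge 1$ and $c(G)+q(G)\ge 3$, and let $\lambda\neq 1$ be a real number. Suppose that $$G-\Gamma(G)=\mathcal{C}_G\cup\mathcal{T}_G\cup\mathcal{P}_G,$$ where $\mathcal{C}_G$ is the disjoint union of graphs $C(g_m,h_m)$ ($1\le m\le c(G)$), $\mathcal{T}_G$ is the disjoint union of graphs $T(k_i,l_i)$ ($1\le i\le q(G)$), and $\mathcal{P}_G$ is the disjoint union of paths $P_{t_j}$ ($1\le j\le|\Gamma(G)|-1$), attached to $\Gamma(G)$ in the way described in the context. Then $G$ is $\lambda$-optimal, i.e. $m_G(\lambda)=2c(G)+q(G)-1$, if and only if all of the following hold: - for every $1\le m\le c(G)$: $m_{C_{g_m}}(\lambda)=2$, $h_m>2$, and $m_{L_v(P_{h_m})}(\lambda)=1$, where $v$ is an arbitrary pendant (end) vertex of $P_{h_m}$; - $m_{B_{k_i,l_i}}(\lambda)=1$ for every $1\le i\le q(G)$; - $m_{U_{t_j}}(\lambda)=1$ for every $1\le j\le|\Gamma(G)|-1$.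
   Context: All graphs are finite and simple. For a graph $G$, $L(G)=D(G)-A(G)$ is the Laplacian matrix, and $m_G(\lambda)$ is the multiplicity of $\lambda$ as an eigenvalue of $L(G)$; for a square matrix $M$, $m_M(\lambda)$ is the multiplicity of $\lambda$ as an eigenvalue of $M$ ($0$ if $\lambda$ is not an eigenvalue, or if $M$ has order $0$). $L_v(G)$ is the submatrix of $L(G)$ obtained by deleting the row and column of the vertex $v$. A pendant vertex is a vertex of degree $1$; a quasi-pendant vertex is a vertex adjacent to a pendant vertex; $q(G)$ is the number of quasi-pendant vertices. For connected $G$, $c(G)=|E(G)|-|V(G)|+1$. $G$ is $\lambda$-optimal if $m_G(\lambda)=2c(G)+q(G)-1$. $C_g$ and $P_l$ are the cycle on $g$ vertices and the path on $l$ vertices. $T(k,l)$ ($k,l\ge 1$): the tree on $k+l$ vertices obtained from the star $K_{1,k}$ by identifying its center with one end vertex of the path $P_l$; the other end vertex of $P_l$ is the $l$-vertex of $T(k,l)$ (if $l=1$, $T(k,1)=K_{1,k}$ and the $1$-vertex is the center). $C(g,l)$ ($g\ge 3$, $l\ge 1$): the graph on $g+l-1$ vertices obtained from the cycle $C_g$ by identifying one of its vertices with one end vertex of $P_l$; the other end vertex of $P_l$ is the $l$-vertex of $C(g,l)$ (if $l=1$, $C(g,1)=C_g$ and the $1$-vertex is the chosen vertex of the cycle). $B_{k,l}$ is the matrix of order $k+l$ obtained from $L(T(k,l+1))$ by deleting the row and column of the $(l+1)$-vertex. $U_n$ is the matrix of order $n$ obtained from $L(P_{n+2})$ by deleting the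 rows and columns of both end vertices of $P_{n+2}$. $\Gamma(G)$ is the set of vertices of $G$ of degree at least $3$ that neither lie on a cycle of $G$ nor are quasi-pendant. Standing assumption on the decomposition of $G-\Gamma(G)$ (all cycles and stars are pendant structures): the $C(g_m,h_m)$, with $h_m\ge1$, contain the cycles of $G$, and each is joined to the rest of $G$ by exactly one edge, from its $h_m$-vertex to a vertex of $\Gamma(G)$; the $T(k_i,l_i)$, with $l_i\ge 1$, contain the quasi-pendant vertices of $G$ (with all their pendant neighbours), and each is joined to the rest of $G$ by exactly one edge, from its $l_i$-vertex to a vertex of $\Gamma(G)$; the $P_{t_j}$ are the internal paths joining pairs of distinct vertices of $\Gamma(G)$ (all vertices of $P_{t_j}$ have degree $2$ in $G$, and the two ends of the path are adjacent to the two respective vertices of $\Gamma(G)$), where $t_j=0$ corresponds to two adjacent vertices of $\Gamma(G)$. *)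

(* Defs.v *)
From mathcomp Require Import all_boot all_order all_algebra.
From mathcomp Require Import boolp reals.

Set Implicit Arguments.
Unset Strict Implicit.
Unset Printing Implicit Defensive.

Import GRing.Theory.

Local Open Scope ring_scope.

(* A simple graph is a symmetric irreflexive relation on a finite type. *)

Section Graphs.
Variables (T : finType) (e : rel T).

Definition degree (x : T) : nat := #|[set y | e x y]|.

Definition pendant (x : T) : bool := degree x == 1%N.

Definition quasi_pendant (x : T) : bool := [exists y, pendant y && e x y].

Definition num_quasi_pendant : nat := #|[set x | quasi_pendant x]|.

Definition edges : {set {set T}} :=
  [set [set p.1; p.2] | p : T * T & e p.1 p.2].

(* The subtraction is not truncated when the graph is connected. *)
Definition cyclomatic : nat := (#|edges| + 1 - #|T|)%N.

Definition connected : Prop := forall x y, connect e x y.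

Definition is_cycle (p : seq T) : Prop :=
  [/\ (3 <= size p)%N, uniq p & cycle e p].

Definition on_cycle (x : T) : Prop := exists2 p, is_cycle p & x \in p.

Definition Gamma : {set T} :=
  [set x | [&& (3 <= degree x)%N, ~~ `[< on_cycle x >] & ~~ quasi_pendant x]].

End Graphs.

Section Laplacian.
Variables (R : realType) (T : finType) (e : rel T).

Definition adjmx : 'M[R]_#|T| := \matrix_(i, j) (e (enum_val i) (enum_val j))%:R.

Definition degmx : 'M[R]_#|T| := diag_mx (\row_i (degree e (enum_val i))%:R).

Definition laplacian : 'M[R]_#|T| := degmx - adjmx.

(* Rows and columns indexed by the vertices in S are deleted. *)
Definition laplacian_del (S : {set T}) : 'M[R]_#|~: S| :=
  let keep (i : 'I_#|~: S|) := enum_rank (enum_val i) in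
  mxsub keep keep laplacian.

End Laplacian.

(* Every matrix to which this is applied is real symmetric, so that geometric *)
(* and algebraic multiplicities agree.                                        *)
Definition mult (R : realType) (n : nat) (M : 'M[R]_n) (lam : R) : nat :=
  \rank (eigenspace M lam).

(* Used only when cyclomatic e >= 1, where the subtraction is not truncated. *)
Definition optimal (R : realType) (T : finType) (e : rel T) (lam : R) : Prop :=
  mult (laplacian R e) lam = (2 * cyclomatic e + num_quasi_pendant e - 1)%N.

Definition symclos (T : Type) (r : rel T) : rel T := fun x y => r x y || r y x.

Definition path_adj (n : nat) : rel 'I_n :=
  symclos (fun i j : 'I_n => j == i.+1 :> nat).

Definition cycle_adj (g : nat) : rel 'I_g :=
  symclos (fun i j : 'I_g => j == (i.+1 %% g)%N :> nat).

(* T(k, l): the leaves of the star are 0, ..., k - 1, its center is k, and the *)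
(* path P_l is k, ..., k + l - 1; its l-vertex is the last vertex k + l - 1.   *)
Definition T_adj (k l : nat) : rel 'I_(k + l) :=
  symclos (fun i j : 'I_(k + l) =>
    if (i < k)%N then j == k :> nat else j == i.+1 :> nat).

(* C(g, l): the cycle C_g is 0, ..., g - 1 and the path P_l is                 *)
(* g - 1, ..., g + l - 2; its l-vertex is the last vertex g + l - 2.           *)
Definition C_adj (g l : nat) : rel 'I_(g + l - 1) :=
  symclos (fun i j : 'I_(g + l - 1) =>
    (j == i.+1 :> nat) || (i == 0%N :> nat) && (j == g.-1 :> nat)).

Definition Bmx (R : realType) (k l : nat) :=
  laplacian_del R (@T_adj k l.+1) [set i : 'I_(k + l.+1) | i == (k + l)%N :> nat].

Definition Umx (R : realType) (n : nat) :=
  laplacian_del R (@path_adj n.+2) [set ord0; ord_max].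

Definition family_adj (I : finType) (V : I -> finType)
    (r : forall i, rel (V i)) : rel {i : I & V i} :=
  fun x y => (tag x == tag y) && r (tag x) (tagged x) (tagged_as x y).

Definition sum_adj (A B : Type) (r : rel A) (s : rel B) : rel (A + B) :=
  fun x y => match x, y with
             | inl a, inl a' => r a a'
             | inr b, inr b' => s b b'
             | _, _ => false
             end.

Section Decomposition.
Variables (T : finType) (e : rel T).
Variables (g h : 'I_(cyclomatic e) -> nat).
Variables (k l : 'I_(num_quasi_pendant e) -> nat).
Variable (t : 'I_(#|Gamma e| - 1) -> nat).

Definition CG := {m : 'I_(cyclomatic e) & 'I_(g m + h m - 1)}.
Definition TG := {i : 'I_(num_quasi_pendant e) & 'I_(k i + l i)}.
Definition PG := {j : 'I_(#|Gamma e| - 1) & 'I_(t j)}.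

Definition CTP_adj : rel (CG + TG + PG) :=
  sum_adj (sum_adj (family_adj (fun m => @C_adj (g m) (h m)))
                   (family_adj (fun i => @T_adj (k i) (l i))))
          (family_adj (fun j => @path_adj (t j))).

Variable f : CG + TG + PG -> T.

Definition C_piece m (x : 'I_(g m + h m - 1)) : T :=
  f (inl (inl (Tagged (fun m => 'I_(g m + h m - 1)) x))).
Definition T_piece i (x : 'I_(k i + l i)) : T :=
  f (inl (inr (Tagged (fun i => 'I_(k i + l i)) x))).
Definition P_piece j (x : 'I_(t j)) : T :=
  f (inr (Tagged (fun j => 'I_(t j)) x)).

(* The piece p has exactly one edge to the rest of the graph, and it goes from *)
(* the last vertex of p to a vertex of Gamma.                                  *)
Definition joined_at_last (n : nat) (p : 'I_n -> T) : Prop :=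
  exists2 w, w \in Gamma e &
    forall (x : 'I_n) y, y \notin codom p ->
      e (p x) y = (x.+1 == n) && (y == w).

(* f is an isomorphism from the disjoint union of the C(g m, h m), T(k i, l i) *)
(* and P_(t j) onto G - Gamma(G); u j and w j are the two vertices of Gamma    *)
(* joined by the j-th internal path. For t j = 0 the walk in dec_P_walk is the *)
(* single edge between u j and w j; dec_P_edge says that the j with t j = 0    *)
(* correspond bijectively to the edges inside Gamma.                           *)
Record decomposition (u w : 'I_(#|Gamma e| - 1) -> T) : Prop := Decomposition {
  dec_C_param : forall m, (3 <= g m)%N /\ (1 <= h m)%N;
  dec_T_param : forall i, (1 <= k i)%N /\ (1 <= l i)%N;
  dec_inj : injective f;
  dec_codom : codom f =i ~: Gamma e;
  dec_adj : forall x y, e (f x) (f y) = CTP_adj x y;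
  dec_C_cycles :
    forall p, is_cycle e p -> exists m, {subset p <= codom (@C_piece m)};
  dec_C_joined : forall m, joined_at_last (@C_piece m);
  dec_T_quasi : forall v, quasi_pendant e v ->
    exists i, v \in codom (@T_piece i) /\
      (forall y, pendant e y -> e v y -> y \in codom (@T_piece i));
  dec_T_joined : forall i, joined_at_last (@T_piece i);
  dec_P_ends : forall j, [/\ u j \in Gamma e, w j \in Gamma e & u j != w j];
  dec_P_degree : forall j (x : 'I_(t j)), degree e (P_piece x) = 2%N;
  dec_P_walk : forall j, path e (u j) (rcons (codom (@P_piece j)) (w j));
  dec_P_edge : forall x y, x \in Gamma e -> y \in Gamma e -> e x y ->
    exists! j, t j = 0%N /\ [set u j; w j] = [set x; y]
}.

End Decomposition.

(* Main.v *)
(* Let K be the space of functions that vanish on Gamma and satisfy the       *)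
(* eigenvalue equation off Gamma. It splits into contributions of the pieces: *)
(* at most 2 from a C(g, h), at most 1 from a T(k, l) or an internal path,    *)
(* with equality exactly when the condition of the theorem on that piece      *)
(* holds. If Y is the space of functions on Gamma orthogonal to the fluxes of *)
(* elements of K into Gamma, Green's identity bounds the multiplicity by      *)
(* dim K + 2 dim Y - |Gamma|, and dim K - |Gamma| is a lower bound. Since     *)
(* Gamma with the internal paths is a tree whose vertices have degree at      *)
(* least 3 in G, a count of the edges at the support of Y shows that the      *)
(* number of pieces violating their condition is at least 2 dim Y + 1 unless  *)
(* Y = 0; so any violation makes the multiplicity strictly smaller.           *)
From HB Require Import structures.
Require Import Defs.
From mathcomp Require Import all_boot all_order all_algebra.
From mathcomp Require Import boolp reals.
From mathcomp Require Import zify ring lra.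

Set Implicit Arguments.
Unset Strict Implicit.
Unset Printing Implicit Defensive.

Import Order.TTheory GRing.Theory Num.Theory.

Local Open Scope ring_scope.

(** * Spaces of functions on a finite set *)

(** Along a piece the eigenvalue equation is a second order recurrence, solved by [chain]. Each
    condition of the theorem thus says that a [chain] value vanishes, or, for a cycle, that all
    solutions are periodic ([cyc_good]); see [mult_Umx], [mult_Bmx], [mult_path_del],
    [mult_cycle_eq2]. The bound h > 2 comes from [lasso_good_gt2].

    Let E be the eigenspace of G and K the space [dirker lam e (Gamma e)]. Elements of K without
    flux into Gamma lie in E, so dim E >= dim K - |Gamma| ([dirkerD_le]); conversely dim E <= dim K
    - |Gamma| + 2 dim Y ([dirker0_dual]). If b pieces are bad, that is, violate their condition,
    then dim K <= 2c + q + |Gamma| - 1 - b ([dim_K_le], [card_free_index]), with equality for b = 0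
    ([dim_K_ge]).

    It remains to see that b > 2 dim Y when Y is nonzero. Let U be the support of Y. A good piece
    carries an element of K with nonzero flux, so no good pendant piece is attached at U, and a good
    internal path ties the values of Y at its two ends ([dual_goodC], [dual_goodT], [dual_goodP]).
    Let i internal paths have both ends in U, r of them good. Degrees at least 3 give 3|U| <= b + i
    + r ([card_attach_ge]); the tree structure gives i < |U| ([inner_lt]) and dim Y <= |U| - r
    ([edge_functionals_dim]). Hence b > 2|U| - r >= 2 dim Y + r. *)

Section Evaluation.
Variables (R : fieldType) (T : finType).
Implicit Types (V : {vspace {ffun T -> R^o}}) (I : finType).

Definition evals I (B : {set I}) (a : I -> T) (x : {ffun T -> R^o}) :
  'rV[R]_#|B| := \row_i x (a (enum_val i)).

Fact evals_is_linear I (B : {set I}) a : linear (@evals I B a).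
Proof. by move=> c x y; apply/rowP=> i; rewrite !mxE !ffunE. Qed.

HB.instance Definition _ I (B : {set I}) a :=
  GRing.isLinear.Build R {ffun T -> R^o} 'rV[R]_#|B| _ (@evals I B a)
    (@evals_is_linear I B a).

Lemma dim_rVf n : \dim (fullv : {vspace 'rV[R]_n}) = n.
Proof. rewrite dimvf dim_matrix. exact: mul1n. Qed.

(** Evaluation at the points [a i] is injective on [V]. Points are named through an index type so
    that coordinates can be labelled by [bool], [unit] or the pieces of a decomposition. *)
Lemma dim_le_evals I (B : {set I}) (a : I -> T) V :
  (forall x, x \in V -> (forall i, i \in B -> x (a i) = 0) -> x = 0) ->
  (\dim V <= #|B|)%N.
Proof.
move=> h; rewrite -(@limg_dim_eq _ _ _ (linfun (evals B a))).
  by rewrite -[X in (_ <= X)%N]dim_rVf dimvS ?subvf.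
apply/eqP; rewrite -subv0; apply/subvP=> x; rewrite memv_cap memv_ker lfunE /=.
case/andP=> xV /eqP/rowP h0; rewrite memv0; apply/eqP/h => // i iB.
by move: (h0 (enum_rank_in iB i)); rewrite !mxE enum_rankK_in.
Qed.

Lemma dim_ge_evals I (B : {set I}) (a : I -> T) V :
  (forall c : I -> R, (forall i, i \notin B -> c i = 0) ->
     exists2 x, x \in V & forall i, i \in B -> x (a i) = c i) ->
  (#|B| <= \dim V)%N.
Proof.
move=> h; rewrite -[X in (X <= _)%N]dim_rVf.
apply: (@leq_trans (\dim (linfun (evals B a) @: V))); last first.
  by rewrite -(limg_ker_dim (linfun (evals B a)) V) leq_addl.
apply/dimvS/subvP=> u _.
pose c i := if [pick j | enum_val j == i] is Some j then u 0 j else 0.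
have [|x xV xc] := h c.
  by move=> i iB; rewrite /c; case: pickP => // j /eqP ji; rewrite -ji enum_valP in iB.
apply/memv_imgP; exists x => //; rewrite lfunE /=; apply/rowP=> i; rewrite !mxE.
rewrite xc ?enum_valP // /c; case: pickP => [j /eqP/enum_val_inj -> //|/(_ i)].
by rewrite eqxx.
Qed.

End Evaluation.

(** * Eigenfunctions with Dirichlet conditions *)

Section LaplaceOperator.
Variables (R : realType) (lam : R).

Definition lapop (T : finType) (e : rel T) (x : {ffun T -> R^o}) (v : T) : R :=
  (degree e v)%:R * x v - \sum_(y | e v y) x y - lam * x v.

(** Packs the Dirichlet condition on [S] and the eigenvalue equation off [S] into one endomorphism,
    so that the solutions form a kernel. *)
Definition dirmap (T : finType) (e : rel T) (S : {set T})
    (x : {ffun T -> R^o}) : {ffun T -> R^o} :=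
  [ffun v => if v \in S then x v else lapop e x v].

Lemma lapop_linear (T : finType) (e : rel T) c (x y : {ffun T -> R^o}) v :
  lapop e (c *: x + y) v = c * lapop e x v + lapop e y v.
Proof.
rewrite /lapop !ffunE; under eq_bigr do rewrite !ffunE.
rewrite big_split /= -scaler_sumr /GRing.scale /=; ring.
Qed.

Fact dirmap_is_linear (T : finType) (e : rel T) (S : {set T}) : linear (@dirmap T e S).
Proof.
move=> c x y; apply/ffunP=> v; rewrite !ffunE lapop_linear.
by case: ifP.
Qed.

HB.instance Definition _ (T : finType) (e : rel T) (S : {set T}) :=
  GRing.isLinear.Build R {ffun T -> R^o} {ffun T -> R^o} _ (@dirmap T e S)
    (@dirmap_is_linear T e S).

Definition dirker (T : finType) (e : rel T) (S : {set T}) := lker (linfun (@dirmap T e S)).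

Lemma dirkerP (T : finType) (e : rel T) (S : {set T}) (x : {ffun T -> R^o}) :
  reflect ((forall v, v \in S -> x v = 0) /\
           (forall v, v \notin S -> lapop e x v = 0)) (x \in dirker e S).
Proof.
rewrite memv_ker lfunE /=; apply: (iffP eqP) => [/ffunP h|[h1 h2]].
  by split=> v vS; move: (h v); rewrite !ffunE ?vS // (negbTE vS).
by apply/ffunP=> v; rewrite !ffunE; case: ifP => vS; rewrite ?h1 ?h2 ?vS.
Qed.

Lemma lapopE (T : finType) (e : rel T) (x : {ffun T -> R^o}) v (s : seq T) :
  uniq s -> (forall y, e v y = (y \in s)) ->
  lapop e x v = ((size s)%:R - lam) * x v - \sum_(y <- s) x y.
Proof.
move=> us es; rewrite /lapop.
have -> : degree e v = size s.
  rewrite /degree -(card_uniqP us); apply: eq_card => y.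
  by rewrite inE es.
rewrite (big_uniq _ us) /= (eq_bigl _ _ es); ring.
Qed.

Lemma lapop_sym (T : finType) (e : rel T) (x y : {ffun T -> R^o}) : symmetric e ->
  \sum_v x v * lapop e y v = \sum_v lapop e x v * y v.
Proof.
move=> es; rewrite /lapop.
have h : \sum_v x v * (\sum_(w | e v w) y w) = \sum_v (\sum_(w | e v w) x w) * y v.
  under eq_bigr do rewrite big_distrr /=.
  under [RHS]eq_bigr do rewrite big_distrl /=.
  by rewrite (exchange_big_dep xpredT) //=; apply: eq_bigr => i _; apply: eq_bigl => j.
transitivity (\sum_v ((degree e v)%:R - lam) * (x v * y v) -
              \sum_v x v * (\sum_(w | e v w) y w)).
  by rewrite -sumrB; apply: eq_bigr => v _; ring.
by rewrite h -sumrB; apply: eq_bigr => v _; ring.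
Qed.

(** Extension by zero to [S] carries eigenvectors of [M] to Dirichlet solutions. The diagonal of [M]
    keeps the degrees of the whole graph, as [lapop] does. *)
Lemma mult_dirker n (M : 'M[R]_n) (T : finType) (e : rel T) (S : {set T})
    (f : 'I_n -> T) : symmetric e -> injective f -> codom f =i ~: S ->
  (forall i j, M i j = (degree e (f i))%:R *+ (i == j) - (e (f i) (f j))%:R) ->
  mult M lam = \dim (dirker e S).
Proof.
move=> es finj fS Me; rewrite /mult.
set W := row_base (eigenspace M lam); set r := \rank _.
pose ext (c : 'rV[R]_r) : {ffun T -> R^o} :=
  [ffun v => if [pick i | f i == v] is Some i then (c *m W) 0 i else 0].
have extf c i : ext c (f i) = (c *m W) 0 i.
  rewrite ffunE; case: pickP => [j /eqP/finj -> //|/(_ i)].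
  by rewrite eqxx.
have ext0 c v : v \in S -> ext c v = 0.
  move=> vS; rewrite ffunE; case: pickP => // j /eqP fj.
  by have := fS v; rewrite inE vS -fj codom_f.
have extlin : linear ext.
  move=> a x y; apply/ffunP=> v; rewrite !ffunE; case: pickP => [i _|_].
    by rewrite mulmxDl -scalemxAl !mxE.
  by rewrite scaler0 addr0.
pose extL : {linear 'rV[R]_r -> {ffun T -> R^o}} :=
  HB.pack ext (GRing.isLinear.Build R 'rV[R]_r {ffun T -> R^o} _ ext extlin).
have memF v : v \notin S -> exists i, v = f i.
  by move=> vS; apply/codomP; rewrite fS inE.
have lapM (x : {ffun T -> R^o}) j : (forall v, v \in S -> x v = 0) ->
    lapop e x (f j) = ((\row_i x (f i)) *m M - lam *: \row_i x (f i)) 0 j.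
  move=> x0; rewrite !mxE /lapop; congr (_ - _).
  under [RHS]eq_bigr do rewrite mxE Me mulrBr.
  rewrite sumrB; congr (_ - _).
    rewrite (bigD1 j) //= big1 => [|i ij]; last by rewrite (negbTE ij) mulr0n mulr0.
    by rewrite eqxx mulr1n addr0 mulrC.
  rewrite big_mkcond /= (bigID [in codom f]) /= [X in _ + X]big1 => [|v]; last first.
    by rewrite fS inE negbK => /x0 ->; case: ifP.
  have us : uniq (codom f) by rewrite map_inj_uniq ?enum_uniq.
  rewrite addr0 -big_uniq //= big_map big_enum /=.
  by apply: eq_bigr => i _; rewrite es; case: ifP => _; rewrite ?mulr1 ?mulr0.
have img : (linfun extL @: fullv)%VS = dirker e S.
  apply/eqP; rewrite eqEsubv; apply/andP; split; apply/subvP=> x.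
    case/memv_imgP=> c _ ->; rewrite lfunE /=; apply/dirkerP; split=> v vS.
      by rewrite ext0.
    have [i ->] := memF _ vS; rewrite lapM; last by move=> ?; exact: ext0.
    have -> : \row_i ext c (f i) = c *m W by apply/rowP=> j; rewrite mxE extf.
    have /eigenspaceP -> : (c *m W <= eigenspace M lam)%MS.
      by rewrite (submx_trans (submxMl _ _)) // eq_row_base.
    by rewrite subrr mxE.
  case/dirkerP=> x0 xe; apply/memv_imgP.
  have : (\row_i x (f i) <= W)%MS.
    rewrite eq_row_base; apply/eigenspaceP/eqP; rewrite -subr_eq0; apply/eqP/rowP=> j.
    rewrite -lapM // xe ?mxE //; have := fS (f j).
    by rewrite inE codom_f => <-.
  case/submxP=> c cE; exists c; first exact: memvf.
  rewrite lfunE /=; apply/ffunP=> v; have [vS|/memF[i ->]] := boolP (v \in S).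
    by rewrite ext0 ?x0.
  by rewrite extf -cE mxE.
rewrite -img limg_dim_eq ?dim_rVf //.
apply/eqP; rewrite -subv0; apply/subvP=> c; rewrite memv_cap memv_ker lfunE /=.
case/andP=> _ /eqP c0; rewrite memv0.
have : c *m W = 0 by apply/rowP=> i; rewrite -extf c0 ffunE mxE.
rewrite -(mul0mx _ W) => /row_free_inj -> //.
by rewrite row_base_free.
Qed.

Lemma laplacianE (T : finType) (e : rel T) i j :
  laplacian R e i j = (degree e (enum_val i))%:R *+ (i == j)
    - (e (enum_val i) (enum_val j))%:R.
Proof. by rewrite !mxE. Qed.

Lemma mult_laplacian (T : finType) (e : rel T) : symmetric e ->
  mult (laplacian R e) lam = \dim (dirker e set0).
Proof.
move=> es; apply: (@mult_dirker _ _ _ _ _ enum_val) => //.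
- exact: enum_val_inj.
- by move=> v; rewrite !inE; apply/codomP; exists (enum_rank v); rewrite enum_rankK.
- exact: laplacianE.
Qed.

(** The automorphism [s] moves the deleted vertices; it serves to turn either end of a path into the
    last vertex. *)
Lemma mult_laplacian_del (T : finType) (e : rel T) (S : {set T})
    (s : T -> T) : symmetric e -> involutive s -> (forall x y, e (s x) (s y) = e x y) ->
  mult (laplacian_del R e S) lam = \dim (dirker e [set x | s x \in S]).
Proof.
move=> es sK se; apply: (@mult_dirker _ _ _ _ _ (fun i => s (enum_val i))) => //.
- by move=> i j /(inv_inj sK)/enum_val_inj.
- move=> v; rewrite !inE; apply/codomP/idP => [[i ->]|vS].
    by rewrite sK; have := enum_valP i; rewrite inE.
  have vS' : s v \in ~: S by rewrite inE.
  by exists (enum_rank_in vS' (s v)); rewrite enum_rankK_in // sK.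
- move=> i j; rewrite mxE laplacianE !enum_rankK se (inj_eq enum_rank_inj).
  rewrite (inj_eq enum_val_inj); congr (_ *+ _ - _); congr _%:R.
  rewrite /degree -(card_imset _ (inv_inj sK)); apply: eq_card => y.
  rewrite inE; apply/imsetP/idP => [[z]|].
    by rewrite inE => ez ->; rewrite se.
  by move=> ey; exists (s y); rewrite ?sK // inE -{1}(sK y) se in ey *.
Qed.

(** Vanishing of the flux imposes at most |S| linear conditions on [dirker e S], and the functions
    satisfying them are eigenfunctions of the whole graph. *)
Lemma dirkerD_le (T : finType) (e : rel T) (S : {set T}) :
  (\dim (dirker e S) <= \dim (dirker e set0) + #|S|)%N.
Proof.
pose nu (x : {ffun T -> R^o}) : {ffun T -> R^o} := [ffun v => lapop e x v].
have nulin : linear nu.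
  by move=> c x y; apply/ffunP=> v; rewrite !ffunE lapop_linear.
pose nuL : {linear {ffun T -> R^o} -> {ffun T -> R^o}} := HB.pack nu
  (GRing.isLinear.Build R _ _ _ nu nulin).
rewrite -(limg_ker_dim (linfun nuL)); apply: leq_add.
  apply/dimvS/subvP=> x; rewrite memv_cap memv_ker lfunE /=.
  case/andP=> _ /eqP/ffunP h; apply/dirkerP; split=> v; first by rewrite inE.
  by move=> _; have := h v; rewrite !ffunE.
apply: (@dim_le_evals _ _ _ S id) => _ /memv_imgP[x /dirkerP[x0 xe] ->].
rewrite lfunE /= => h; apply/ffunP=> v; rewrite !ffunE.
by have [/h|/xe //] := boolP (v \in S); rewrite ffunE.
Qed.

(** The form is positive definite over the reals, so [U] and [V] meet in 0 and their direct sum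
    embeds into the functions on [S]. *)
Lemma orthogonal_dim_le (T : finType) (S : {set T}) (U V : {vspace {ffun T -> R^o}}) :
  (forall x y, x \in U -> y \in V -> \sum_v x v * y v = 0) ->
  (forall x v, x \in U -> v \notin S -> x v = 0) ->
  (forall y v, y \in V -> v \notin S -> y v = 0) ->
  (\dim U + \dim V <= #|S|)%N.
Proof.
move=> UV U0 V0; rewrite -dimv_disjoint_sum; last first.
  apply/eqP; rewrite -subv0; apply/subvP=> x; rewrite memv_cap memv0.
  case/andP=> xU xV; apply/eqP/ffunP=> v; rewrite ffunE.
  have /eqP := UV _ _ xU xV; rewrite psumr_eq0 => [|w _]; last first.
    by rewrite -expr2 sqr_ge0.
  by move/allP/(_ v (mem_index_enum _)); rewrite /= mulf_eq0 orbb => /eqP.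
apply: (@dim_le_evals _ _ _ S id) => _ /memv_addP[x xU [y yV ->]] h.
apply/ffunP=> v; have [vS|vS] := boolP (v \in S); first by rewrite [LHS]h ?ffunE.
by rewrite !ffunE (U0 _ _ xU vS) (V0 _ _ yV vS) addr0.
Qed.

(* The inequality comes from Green's identity: restrictions to S of elements  *)
(* of the kernel are orthogonal to the fluxes into S of elements of           *)
(* [dirker e S], and Y is the orthogonal complement of these fluxes.          *)
Lemma dirker0_dual (T : finType) (e : rel T) (S : {set T}) : symmetric e ->
  exists Y : {vspace {ffun T -> R^o}},
  [/\ forall y v, y \in Y -> v \notin S -> y v = 0,
      forall x y, x \in dirker e S -> y \in Y -> \sum_v y v * lapop e x v = 0
    & (\dim (dirker e set0) + #|S| <= \dim (dirker e S) + 2 * \dim Y)%N].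
Proof.
move=> es; set E := dirker e set0; set K := dirker e S.
pose nu (x : {ffun T -> R^o}) : {ffun T -> R^o} := [ffun v => lapop e x v].
have nulin : linear nu.
  by move=> c x y; apply/ffunP=> v; rewrite !ffunE lapop_linear.
pose nuL : {linear {ffun T -> R^o} -> {ffun T -> R^o}} := HB.pack nu
  (GRing.isLinear.Build R _ _ _ nu nulin).
pose rho (x : {ffun T -> R^o}) : {ffun T -> R^o} :=
  [ffun v => if v \in S then x v else 0].
have rholin : linear rho.
  move=> c x y; apply/ffunP=> v; rewrite !ffunE; case: ifP => // _.
  by rewrite scaler0 addr0.
pose rhoL : {linear {ffun T -> R^o} -> {ffun T -> R^o}} := HB.pack rho
  (GRing.isLinear.Build R _ _ _ rho rholin).
pose N := (linfun nuL @: K)%VS.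
have N0 x v : x \in N -> v \notin S -> x v = 0.
  by case/memv_imgP=> k /dirkerP[_ ke] -> vS; rewrite lfunE /= ffunE ke.
pose F := (linfun rhoL @: fullv)%VS.
have FS (y : {ffun T -> R^o}) : (forall v, v \notin S -> y v = 0) -> y \in F.
  move=> y0; apply/memv_imgP; exists y; first exact: memvf.
  rewrite lfunE /=; apply/ffunP=> v; rewrite ffunE; case: ifP => // /negbT.
  exact: y0.
have F0 (y : {ffun T -> R^o}) v : y \in F -> v \notin S -> y v = 0.
  by case/memv_imgP=> k _ -> vS; rewrite lfunE /= ffunE (negbTE vS).
have dF : (#|S| <= \dim F)%N.
  apply: (@dim_ge_evals _ _ _ S id) => c _.
  exists [ffun v => if v \in S then c v else 0].
    by apply: FS => v vS; rewrite ffunE (negbTE vS).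
  by move=> i iS; rewrite ffunE iS.
pose phi (y : {ffun T -> R^o}) : 'rV[R]_(\dim N) :=
  \row_i \sum_v y v * (vbasis N)`_i v.
have philin : linear phi.
  move=> c x y; apply/rowP=> i; rewrite !mxE mulr_sumr -big_split /=.
  by apply: eq_bigr => v _; rewrite !ffunE mulrDl /GRing.scale /= mulrA.
pose phiL : {linear {ffun T -> R^o} -> 'rV[R]_(\dim N)} := HB.pack phi
  (GRing.isLinear.Build R {ffun T -> R^o} 'rV[R]_(\dim N) _ phi philin).
pose Y := (F :&: lker (linfun phiL))%VS.
have dY : (#|S| <= \dim Y + \dim N)%N.
  rewrite (leq_trans dF) // -(limg_ker_dim (linfun phiL) F) leq_add2l.
  by rewrite -[X in (_ <= X)%N](@dim_rVf R) dimvS ?subvf.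
exists Y; split=> [y v||].
- by rewrite memv_cap => /andP[/F0 h _]; exact: h.
- move=> x y xK; rewrite memv_cap memv_ker lfunE /= => /andP[_ /eqP/rowP y0].
  have xN : nu x \in N by rewrite -[nu x]/(nuL x) -lfunE memv_img.
  have -> : \sum_v y v * lapop e x v = \sum_v y v * nu x v.
    by apply: eq_bigr => v _; rewrite [nu x v]ffunE.
  rewrite {1}(coord_vbasis xN).
  under eq_bigr => v _ do rewrite sum_ffunE mulr_sumr.
  rewrite exchange_big big1 //= => i _.
  transitivity (coord (vbasis N) i (nu x) * phi y 0 i).
    rewrite mxE mulr_sumr; apply: eq_bigr => v _; rewrite !ffunE /GRing.scale /=.
    by rewrite mulrCA.
  by rewrite y0 mxE mulr0.
(* An eigenfunction vanishing on [S] is an element of [K] without flux. *)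
have dK : (\dim (E :&: lker (linfun rhoL)) <= \dim (K :&: lker (linfun nuL)))%N.
  apply/dimvS/subvP=> x; rewrite !memv_cap => /andP[/dirkerP[_ xe]].
  rewrite memv_ker lfunE => /eqP/ffunP x0; apply/andP; split.
    apply/dirkerP; split=> v vS; first by have := x0 v; rewrite /= !ffunE vS.
    by apply: xe; rewrite inE.
  by rewrite memv_ker lfunE /=; apply/eqP/ffunP=> v; rewrite !ffunE xe ?inE.
have dE : (\dim (linfun rhoL @: E) + \dim N <= #|S|)%N.
  apply: orthogonal_dim_le => //.
    move=> _ _ /memv_imgP[z /dirkerP[_ ze] ->] /memv_imgP[x /dirkerP[x0 xe] ->].
    rewrite !lfunE /=; transitivity (\sum_v z v * lapop e x v).
      apply: eq_bigr => v _; rewrite !ffunE; case: ifP => // /negbT vS.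
      by rewrite (xe _ vS) !mulr0.
    by rewrite lapop_sym // big1 // => v _; rewrite ze ?mul0r ?inE.
  by move=> x v /memv_imgP[z _ ->] vS; rewrite lfunE /= ffunE (negbTE vS).
have arith a b c d k s y n : (s <= y + n -> a <= c -> b + n <= s ->
  a + b = d -> c + n = k -> d + s <= k + 2 * y)%N by lia.
exact: arith dY dK dE (limg_ker_dim _ E) (limg_ker_dim _ K).
Qed.

End LaplaceOperator.

(** * Eigenvalue equations on paths, stars and cycles *)

Section Recurrence.
Variables (R : realType) (lam : R).

(** The eigenvalue equation through vertices of degree 2. The values [chain 0 1 n.+1] are Chebyshev
    polynomials of the second kind at 1 - lam/2, equal to det(U_n - lam). *)
Fixpoint chain (a b : R) (n : nat) : R :=
  match n with
  | 0 => a
  | (n'.+1 as n1).+1 => (2 - lam) * chain a b n1 - chain a b n'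
  | 1 => b
  end.

Lemma chainSS a b n : chain a b n.+2 = (2 - lam) * chain a b n.+1 - chain a b n.
Proof. by []. Qed.

Lemma two_step (P : nat -> Prop) :
  P 0%N -> P 1%N -> (forall n, P n -> P n.+1 -> P n.+2) -> forall n, P n.
Proof.
move=> h0 h1 hS n; suff [] : P n /\ P n.+1 by [].
by elim: n => // n [pn pn1]; split=> //; exact: hS.
Qed.

Lemma chain_lin c d a b a' b' n :
  chain (c * a + d * a') (c * b + d * b') n = c * chain a b n + d * chain a' b' n.
Proof.
elim/two_step: n => // n IH1 IH2; rewrite !chainSS IH1 IH2; ring.
Qed.

Lemma chain_scale c a b n : chain (c * a) (c * b) n = c * chain a b n.
Proof.
by have := chain_lin c 0 a b 0 0 n; rewrite !mul0r !addr0.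
Qed.

Lemma chain_basis a b n : chain a b n = a * chain 1 0 n + b * chain 0 1 n.
Proof. by rewrite -chain_lin !mulr1 !mulr0 addr0 add0r. Qed.

Lemma chain_shift a b n : chain a b n.+1 = chain b ((2 - lam) * b - a) n.
Proof.
elim/two_step: n => // n IH1 IH2.
by rewrite chainSS IH2 IH1 -chainSS.
Qed.

Lemma chain_uniq (X : nat -> R) N :
  (forall i, (i.+2 <= N)%N -> X i.+2 = (2 - lam) * X i.+1 - X i) ->
  forall n, (n <= N)%N -> X n = chain (X 0%N) (X 1%N) n.
Proof.
move=> h; elim/two_step=> // n IH1 IH2 nN.
by rewrite h // chainSS IH1 ?IH2 // ltnW // ltnW.
Qed.

Lemma chain_00 n : chain 0 0 n = 0.
Proof. by rewrite chain_basis !mul0r addr0. Qed.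

(** The recurrence also runs backwards. This is why a nonzero solution vanishing at an attachment
    vertex has nonzero flux there. *)
Lemma chain_eq0 a b n : chain a b n = 0 -> chain a b n.+1 = 0 -> a = 0 /\ b = 0.
Proof.
elim: n => [|n IH] h1 h2; first by split.
apply: (IH _ h1).
by move: h2; rewrite chainSS h1 mulr0 sub0r => /eqP; rewrite oppr_eq0 => /eqP.
Qed.

Lemma chain10 n : chain 1 0 n.+1 = - chain 0 1 n.
Proof.
rewrite chain_shift mulr0 sub0r; have := chain_scale (-1) 0 1 n.
by rewrite mulr0 mulr1 mulN1r => <-.
Qed.

(* The eigenvalue equation at i, for the graph with neighbour lists nb. *)
Definition loceq (nb : nat -> seq nat) (X : nat -> R) (i : nat) : R :=
  ((size (nb i))%:R - lam) * X i - \sum_(a <- nb i) X a.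

Lemma eq_loceq nb X X' i : X i = X' i -> (forall a, a \in nb i -> X a = X' a) ->
  loceq nb X i = loceq nb X' i.
Proof. by move=> hi h; rewrite /loceq hi (eq_big_seq X'). Qed.

Lemma loceq2 (nb : nat -> seq nat) X i a b : nb i = [:: a; b] -> loceq nb X i = 0 <->
  X b = (2 - lam) * X i - X a.
Proof. rewrite /loceq => ->; rewrite !big_cons big_nil /=; split=> h; lra. Qed.

Lemma loceq1 (nb : nat -> seq nat) X i a : nb i = [:: a] -> loceq nb X i = 0 <->
  X a = (1 - lam) * X i.
Proof. rewrite /loceq => ->; rewrite !big_cons big_nil /=; split=> h; lra. Qed.

(* Interior vertices of a path only: nbP 0 = [:: 0; 1] is a junk value. *)
Definition nbP (i : nat) : seq nat := [:: i.-1; i.+1].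

Lemma path_uniq t X : (forall i, (i < t)%N -> loceq nbP X i.+1 = 0) ->
  forall n, (n <= t.+1)%N -> X n = chain (X 0%N) (X 1%N) n.
Proof.
move=> h; apply: chain_uniq => i it.
by have /(@loceq2 nbP X i.+1 i i.+2 erefl) := h i it.
Qed.

Lemma path_sol a b i : loceq nbP (chain a b) i.+1 = 0.
Proof. exact/(@loceq2 nbP _ i.+1 i i.+2 erefl). Qed.

Definition nbH (i : nat) : seq nat := if i == 0%N then [:: 1%N] else nbP i.

Lemma half_uniq t X : (forall i, (i < t)%N -> loceq nbH X i = 0) ->
  forall n, (n <= t)%N -> X n = X 0%N * chain 1 (1 - lam) n.
Proof.
move=> h; case: t h => [|t] h n nt; first by move: nt; rewrite leqn0 => /eqP->; rewrite mulr1.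
rewrite -chain_scale mulr1 (@chain_uniq _ t.+1) //; last first.
  move=> i it; have /(@loceq2 nbH X i.+1 i i.+2 erefl) -> //:= h i.+1 it.
have /(@loceq1 nbH X 0%N 1%N erefl) -> := h 0%N isT.
by rewrite mulrC.
Qed.

Lemma half_sol i : loceq nbH (chain 1 (1 - lam)) i = 0.
Proof.
case: i => [|i]; last exact/(@loceq2 nbH _ i.+1 i i.+2 erefl).
by apply/(@loceq1 nbH _ 0%N 1%N erefl); rewrite /= mulr1.
Qed.

(* T(k, l) with the path continued indefinitely beyond its l-vertex. *)
Definition nbT (k i : nat) : seq nat :=
  if (i < k)%N then [:: k] else if i == k then k.+1 :: iota 0 k else nbP i.

(** Values along the path of T(k, l), normalised to 1 at the center. The leaves then have value 1/(1
    - lam), and the second entry is the equation at the center, of degree k + 1. Entry [l] belongs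
    to the attachment vertex. *)
Definition starchain (k : nat) : nat -> R :=
  chain 1 (k%:R + 1 - lam - k%:R / (1 - lam)).

Definition solT (k : nat) (c : R) (a : nat) : R :=
  if (a < k)%N then c / (1 - lam) else c * starchain k (a - k).

Lemma loceqT_center k X c : (forall a, (a < k)%N -> X a = c) ->
  loceq (nbT k) X k = 0 <-> X k.+1 = (k%:R + 1 - lam) * X k - k%:R * c.
Proof.
move=> h; rewrite /loceq /nbT ltnn eqxx /= size_iota big_cons.
have -> : \sum_(a <- iota 0 k) X a = k%:R * c.
  rewrite (eq_big_seq (fun=> c)) => [|a]; last by rewrite mem_iota => /h.
  by rewrite big_const_seq count_predT size_iota iter_addr_0 mulr_natl.
by rewrite -natr1; split=> h'; lra.
Qed.

Lemma star_uniq k l X : lam != 1 -> (0 < l)%N ->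
  (forall i, (i < k + l)%N -> loceq (nbT k) X i = 0) ->
  forall a, (a <= k + l)%N -> X a = solT k (X k) a.
Proof.
move=> lam1 l0 h.
have lam1' : 1 - lam != 0 by rewrite subr_eq0 eq_sym.
have hleaf a : (a < k)%N -> X a = X k / (1 - lam).
  move=> ak; have nba : nbT k a = [:: k] by rewrite /nbT ak.
  have /(loceq1 _ nba) -> := h a (ltn_addr _ ak).
  by rewrite mulrC mulKf.
have /(loceqT_center hleaf) h1 : loceq (nbT k) X k = 0 by apply: h; lia.
move=> a akl; rewrite /solT; case: ltnP => [/hleaf//|ka].
rewrite /starchain -chain_scale mulr1.
have -> : X k * (k%:R + 1 - lam - k%:R / (1 - lam)) = X k.+1 by rewrite h1; field.
have := @chain_uniq (fun i => X (k + i)%N) l _ (a - k)%N.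
rewrite addn0 addn1 subnKC //; apply; last by lia.
move=> i il; have nbi : nbT k (k + i.+1)%N = [:: (k + i)%N; (k + i.+2)%N].
  by rewrite /nbT /nbP ifF ?ifF; [congr [:: _; _] | |]; lia.
by have /(loceq2 _ nbi) := h (k + i.+1)%N ltac:(lia).
Qed.

Lemma star_sol k c i : lam != 1 -> loceq (nbT k) (solT k c) i = 0.
Proof.
move=> lam1; have lam1' : 1 - lam != 0 by rewrite subr_eq0 eq_sym.
have [ik|ki|->] := ltngtP i k.
- have nbi : nbT k i = [:: k] by rewrite /nbT ik.
  by apply/(loceq1 _ nbi); rewrite /solT ik ltnn subnn mulr1 mulrC divfK.
- have nbi : nbT k i = [:: i.-1; i.+1] by rewrite /nbT /nbP ifF ?ifF //; lia.
  apply/(loceq2 _ nbi); rewrite /solT !ifF; try lia.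
  have -> : (i.+1 - k = (i - k).-1.+2)%N by lia.
  have -> : (i - k = (i - k).-1.+1)%N by lia.
  have -> : (i.-1 - k = (i - k).-1)%N by lia.
  rewrite /starchain chainSS /=; ring.
- have hc a : (a < k)%N -> solT k c a = c / (1 - lam) by rewrite /solT => ->.
  apply/(loceqT_center hc); rewrite /solT !ifF; try lia.
  by rewrite subSnn subnn /starchain /=; field.
Qed.

(* C(g, l) with the path continued indefinitely beyond its l-vertex. *)
Definition nbC (g i : nat) : seq nat :=
  if i == 0%N then [:: g.-1; 1%N]
  else if i == g.-1 then [:: 0%N; g.-2; g] else nbP i.

(** The transfer matrix of the recurrence over [g] steps is the identity, so that all solutions are
    [g]-periodic ([cyc_good_chain]). *)
Definition cyc_good (g : nat) : bool :=
  (chain 0 1 g == 0) && (chain 0 1 g.+1 == 1).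

(* The cycle equation at the junction g.-1, given X g.-1 = c1 on both sides,  *)
(* makes the next vertex of the path also take the value c1.                  *)
Definition solC (g : nat) (c0 c1 : R) (a : nat) : R :=
  if (a < g)%N then chain c1 c0 a.+1 else chain c1 c1 (a.+1 - g).

Lemma cyc_good10 g : cyc_good g -> chain 1 0 g = 1.
Proof.
case: g => // g /andP[/eqP h0]; rewrite chainSS h0 chain10 => /eqP h1; lra.
Qed.

Lemma cyc_goodP g : (0 < g)%N -> chain 0 1 g = 0 -> chain 1 0 g = 1 -> cyc_good g.
Proof.
case: g => // g _; rewrite /cyc_good chainSS chain10 => -> h1.
by rewrite eqxx; apply/eqP; lra.
Qed.

Lemma cyc_good_chain g a b : cyc_good g -> chain a b g = a /\ chain a b g.+1 = b.
Proof.
move=> gg; have := cyc_good10 gg; case/andP: gg => /eqP h0 /eqP h1 h2.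
split; rewrite chain_basis; first by rewrite h0 h2; ring.
by rewrite chain10 h1 h0; ring.
Qed.

(** The cycle is cut open before vertex 0, whose predecessor is [g.-1]. The equation at [g.-1]
    itself is left out, so the statement covers both the lone cycle and the cycle of C(g, l). *)
Lemma cyc_arc g nb X : (0 < g)%N -> nb 0%N = [:: g.-1; 1%N] ->
  (forall i, (0 < i < g.-1)%N -> nb i = nbP i) ->
  (forall i, (i < g.-1)%N -> loceq nb X i = 0) ->
  forall a, (a < g)%N -> X a = chain (X g.-1) (X 0%N) a.+1.
Proof.
case: g => // g _ /= nb0 nbi h; case: g => [|g] in nb0 nbi h *.
  by case.
(* After the two case analyses the last cycle vertex is [g.+1]; its value is put in front of that of
   vertex 0. *)
pose X' i := if i is i'.+1 then X i' else X g.+1.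
move=> a ag; apply: (@chain_uniq X' g.+2 _ a.+1) => //.
case=> [|i] ig /=; first by have /(loceq2 _ nb0) := h 0%N isT.
have nbi1 : nb i.+1 = [:: i; i.+2] by rewrite nbi //; lia.
by have /(loceq2 _ nbi1) := h i.+1 ltac:(lia).
Qed.

Lemma lasso_arc g X : (3 <= g)%N -> (forall i, (i < g.-1)%N -> loceq (nbC g) X i = 0) ->
  forall a, (a < g)%N -> X a = chain (X g.-1) (X 0%N) a.+1.
Proof.
move=> g3; apply: cyc_arc => //; first by lia.
by move=> i ig; rewrite /nbC ifF ?ifF //; lia.
Qed.

Lemma loceqC_junction g X : (3 <= g)%N -> loceq (nbC g) X g.-1 = 0 <->
  X g = (3 - lam) * X g.-1 - X g.-2 - X 0%N.
Proof.
move=> g3; rewrite /loceq /nbC ifF ?eqxx /=; last by lia.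
rewrite !big_cons big_nil; split=> h; lra.
Qed.

Lemma lasso_tail g n X : (3 <= g <= n)%N ->
  (forall i, (i < n)%N -> loceq (nbC g) X i = 0) ->
  forall j, (g.-1 + j <= n)%N -> X (g.-1 + j)%N = chain (X g.-1) (X g) j.
Proof.
move=> /andP[g3 gn] h j jn.
have := @chain_uniq (fun i => X (g.-1 + i)%N) (n - g.-1) _ j.
rewrite addn0 addn1 prednK; last by lia.
apply; last by lia.
move=> i il; have nbi : nbC g (g.-1 + i.+1)%N = [:: (g.-1 + i)%N; (g.-1 + i.+2)%N].
  by rewrite /nbC /nbP ifF ?ifF; [congr [:: _; _] | |]; lia.
by have /(loceq2 _ nbi) := h (g.-1 + i.+1)%N ltac:(lia).
Qed.

Lemma lasso_zero g n X : (3 <= g <= n)%N ->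
  (forall i, (i < n)%N -> loceq (nbC g) X i = 0) ->
  X 0%N = 0 -> X g.-1 = 0 -> forall a, (a <= n)%N -> X a = 0.
Proof.
move=> gn h X0 X1; have /andP[g3 _] := gn.
have harc a : (a < g)%N -> X a = 0.
  move=> ag; rewrite (@lasso_arc g X) // ?X0 ?X1 ?chain_00 // => i ig.
  by apply: h; lia.
have Xg : X g = 0.
  have /(loceqC_junction X g3) -> : loceq (nbC g) X g.-1 = 0 by apply: h; lia.
  by rewrite !harc; [ring | lia..].
move=> a an; have [/harc //|ga] := ltnP a g.
have -> : a = (g.-1 + (a - g.-1))%N by lia.
by rewrite (lasso_tail gn) ?X1 ?Xg ?chain_00 //; lia.
Qed.

(** By periodicity the cycle satisfies its own equation at the junction, so the extra term there
    forces [X g = X g.-1]. The tail then starts with two equal values. *)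
Lemma lasso_good_tail g n X : (3 <= g <= n)%N -> cyc_good g ->
  (forall i, (i < n)%N -> loceq (nbC g) X i = 0) ->
  X n = X g.-1 * chain 1 1 (n.+1 - g).
Proof.
move=> gn gg h; have /andP[g3 _] := gn.
have Xg : X g = X g.-1.
  have /(loceqC_junction X g3) -> : loceq (nbC g) X g.-1 = 0 by apply: h; lia.
  have arc : forall a, (a < g)%N -> X a = chain (X g.-1) (X 0%N) a.+1.
    by apply: lasso_arc => // i ig; apply: h; lia.
  have := (cyc_good_chain (X g.-1) (X 0%N) gg).2.
  have e2 : X g.-2 = chain (X g.-1) (X 0%N) g.-1 by rewrite arc; [congr chain|]; lia.
  have e1 : X g.-1 = chain (X g.-1) (X 0%N) g.-1.+1 by rewrite {1}arc //; lia.
  have -> : g.+1 = g.-1.+2 by lia.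
  rewrite chainSS -e1 -e2 => e; lra.
rewrite -chain_scale mulr1 -[in RHS]Xg Xg.
have {1}-> : n = (g.-1 + (n.+1 - g))%N by lia.
by rewrite (lasso_tail gn) // ?Xg //; lia.
Qed.

(** The second condition says that lam is an eigenvalue of L_v(P_h), by [mult_path_del]; it is also
    the vanishing of the tail at the attachment vertex. *)
Definition lasso_good (g h : nat) : bool := cyc_good g && (chain 1 1 h == 0).

(** The values of [chain 1 1] at 0, 1, 2 are 1, 1, 1 - lam. *)
Lemma lasso_good_gt2 g h : lam != 1 -> lasso_good g h -> (2 < h)%N.
Proof.
move=> lam1 /andP[_]; case: h => [|[|[|//]]] /=; rewrite ?oner_eq0 //.
by rewrite mulr1 -addrAC (_ : 2 - 1 = 1 :> R) ?subr_eq0 1?eq_sym ?(negbTE lam1) //; ring.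
Qed.

(* If the conditions on C(g, h) fail, then on solutions vanishing at the      *)
(* attachment vertex one of the two coordinates X 0, X g.-1 determines the    *)
(* other.                                                                     *)
Lemma lasso_bad g h X : (3 <= g)%N -> (1 <= h)%N -> ~~ lasso_good g h ->
  (forall i, (i < g + h - 1)%N -> loceq (nbC g) X i = 0) ->
  X (g + h - 1)%N = 0 ->
  if chain 0 1 g == 0 then X 0%N = 0 -> X g.-1 = 0 else X g.-1 = 0 -> X 0%N = 0.
Proof.
move=> g3 h1 bad hX Xn.
have e1 : X g.-1 = X g.-1 * chain 1 0 g + X 0%N * chain 0 1 g.
  rewrite -chain_basis {1}(@lasso_arc g X) ?prednK //; try lia.
  by move=> i ig; apply: hX; lia.
case: ifP => [/eqP c0 X0|/negbT c0 X1]; last first.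
  by move/eqP: e1; rewrite X1 mul0r add0r eq_sym mulf_eq0 (negbTE c0) orbF => /eqP.
move/eqP: e1; rewrite c0 mulr0 addr0 -{1}[X _]mulr1 -subr_eq0 -mulrBr mulf_eq0.
case/orP=> [/eqP //|]; rewrite subr_eq0 => /eqP c1.
have gg : cyc_good g by apply: cyc_goodP => //; lia.
have := @lasso_good_tail g (g + h - 1) X ltac:(lia) gg hX.
rewrite Xn (_ : (g + h - 1).+1 - g = h)%N; last by lia.
by move/esym/eqP; rewrite mulf_eq0 => /orP[/eqP//|]; move: bad; rewrite /lasso_good gg /= => /negbTE ->.
Qed.

Lemma lasso_sol g c0 c1 i : (3 <= g)%N -> cyc_good g -> loceq (nbC g) (solC g c0 c1) i = 0.
Proof.
move=> g3 gg; have [cg cg1] := cyc_good_chain c1 c0 gg.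
have sg1 : solC g c0 c1 g.-1 = c1.
  by rewrite /solC ifT ?prednK ?cg //; lia.
have sg : solC g c0 c1 g = c1 by rewrite /solC ltnn subSnn.
have [ig|gi|->] := ltngtP i g.-1.
- have [->|i0] := eqVneq i 0%N.
    have nb0 : nbC g 0 = [:: g.-1; 1%N] by [].
    apply/(loceq2 _ nb0); rewrite sg1 /solC !ifT //; lia.
  have nbi : nbC g i = [:: i.-1; i.+1] by rewrite /nbC ifF ?ifF //; lia.
  apply/(loceq2 _ nbi); rewrite /solC !ifT; try lia.
  by rewrite prednK ?chainSS //; lia.
- have nbi : nbC g i = [:: i.-1; i.+1] by rewrite /nbC ifF ?ifF //; lia.
  apply/(loceq2 _ nbi).
  have tail j : (g.-1 <= j)%N -> solC g c0 c1 j = chain c1 c1 (j - g.-1).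
    move=> gj; have [->|jg] := eqVneq j g.-1; first by rewrite sg1 subnn.
    by rewrite /solC ifF; [congr chain|]; lia.
  rewrite !tail; try lia.
  have -> : (i.+1 - g.-1 = (i - g).+2)%N by lia.
  have -> : (i - g.-1 = (i - g).+1)%N by lia.
  by have -> : (i.-1 - g.-1 = i - g)%N by lia.
- apply/loceqC_junction => //; rewrite sg sg1 /solC !ifT; try lia.
  have e : chain c1 c0 g.+1 = (2 - lam) * chain c1 c0 g - chain c1 c0 g.-2.+1.
    have {1 2}-> : g = g.-2.+2 by lia.
    by rewrite chainSS.
  rewrite cg cg1 in e; rewrite (_ : chain c1 c0 1 = c0) //; lra.
Qed.

Definition nbR (g i : nat) : seq nat :=
  if i == 0%N then [:: g.-1; 1%N]
  else if i == g.-1 then [:: g.-2; 0%N] else nbP i.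

Lemma ring_arc g X : (3 <= g)%N -> (forall i, (i < g)%N -> loceq (nbR g) X i = 0) ->
  (forall a, (a < g)%N -> X a = chain (X g.-1) (X 0%N) a.+1) /\
  X 0%N = chain (X g.-1) (X 0%N) g.+1.
Proof.
move=> g3 h.
have arc a : (a < g)%N -> X a = chain (X g.-1) (X 0%N) a.+1.
  apply: (@cyc_arc g (nbR g)) => //; first by lia.
    by move=> i ig; rewrite /nbR ifF ?ifF //; lia.
  by move=> i ig; apply: h; lia.
split=> //; have nbg : nbR g g.-1 = [:: g.-2; 0%N] by rewrite /nbR ifF ?eqxx //; lia.
have /(loceq2 _ nbg) {1}-> : loceq (nbR g) X g.-1 = 0 by apply: h; lia.
have -> : g.+1 = g.-1.+2 by lia.
rewrite chainSS -!arc; try lia.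
by congr (_ - _); rewrite arc; [congr chain|]; lia.
Qed.

Lemma ring_sol g c0 c1 i : (3 <= g)%N -> (i < g)%N -> cyc_good g ->
  loceq (nbR g) (fun a => chain c1 c0 a.+1) i = 0.
Proof.
move=> g3 ig gg; have [cg cg1] := cyc_good_chain c1 c0 gg.
have [->|i0] := eqVneq i 0%N.
  apply/(@loceq2 (nbR g) _ 0%N g.-1 1%N erefl).
  by rewrite prednK ?cg //; lia.
have [->|i1] := eqVneq i g.-1.
  have nbg : nbR g g.-1 = [:: g.-2; 0%N] by rewrite /nbR ifF ?eqxx //; lia.
  apply/(loceq2 _ nbg); rewrite -[LHS]cg1.
  have -> : g.+1 = g.-2.+3 by lia.
  by have -> : g.-1 = g.-2.+1 by lia.
have nbi : nbR g i = [:: i.-1; i.+1] by rewrite /nbR ifF ?ifF //; lia.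
by apply/(loceq2 _ nbi); rewrite prednK ?chainSS //; lia.
Qed.

Lemma ring_bad g X : (3 <= g)%N -> ~~ cyc_good g ->
  (forall i, (i < g)%N -> loceq (nbR g) X i = 0) ->
  if chain 0 1 g == 0 then X 0%N = 0 -> X g.-1 = 0 else X g.-1 = 0 -> X 0%N = 0.
Proof.
move=> g3 bad hX; have [arc _] := ring_arc g3 hX.
have e1 : X g.-1 = X g.-1 * chain 1 0 g + X 0%N * chain 0 1 g.
  by rewrite -chain_basis {1}arc ?prednK //; lia.
case: ifP => [/eqP c0 X0|/negbT c0 X1]; last first.
  by move/eqP: e1; rewrite X1 mul0r add0r eq_sym mulf_eq0 (negbTE c0) orbF => /eqP.
move/eqP: e1; rewrite c0 mulr0 addr0 -{1}[X _]mulr1 -subr_eq0 -mulrBr mulf_eq0.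
case/orP=> [/eqP //|]; rewrite subr_eq0 => /eqP c1.
by move: bad; rewrite cyc_goodP //; lia.
Qed.

End Recurrence.

(** * The model graphs as neighbour lists on natural numbers *)

Section NeighbourLists.

Lemma path_adj_nbH n (i j : 'I_n) : path_adj i j = ((j : nat) \in nbH i).
Proof.
rewrite /path_adj /symclos /nbH /nbP; case: (nat_of_ord i) => [|i'] /=; rewrite !inE; lia.
Qed.

Lemma T_adj_nbT k l (i j : 'I_(k + l)) : T_adj i j = ((j : nat) \in nbT k i).
Proof.
rewrite /T_adj /symclos /nbT /nbP; move: (nat_of_ord i) (nat_of_ord j) => a b.
by case: ltngtP => ak; rewrite !inE ?mem_iota; case: ltnP; lia.
Qed.

Lemma C_adj_nbC g h (i j : 'I_(g + h - 1)) : (3 <= g)%N ->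
  C_adj i j = ((j : nat) \in nbC g i).
Proof.
move=> g3; rewrite /C_adj /symclos /nbC /nbP.
move: (nat_of_ord i) (nat_of_ord j) => a b.
by have [->|a0] := eqVneq a 0%N; [|have [->|ag] := eqVneq a g.-1]; rewrite !inE; lia.
Qed.

Lemma cycle_adj_nbR g (i j : 'I_g) : (3 <= g)%N -> cycle_adj i j = ((j : nat) \in nbR g i).
Proof.
move=> g3; rewrite /cycle_adj /symclos /nbR /nbP.
have S_mod a : (a < g)%N -> (a.+1 %% g = if a == g.-1 then 0 else a.+1)%N.
  move=> ag; case: eqP => [->|an]; first by rewrite prednK ?modnn; lia.
  by rewrite modn_small //; lia.
rewrite !S_mod //; move: (ltn_ord i) (ltn_ord j).
move: (nat_of_ord i) (nat_of_ord j) => a b alt blt.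
case: (a =P g.-1) => ag; case: (b =P g.-1) => bg; case: (a =P 0%N) => a0;
  rewrite !inE; lia.
Qed.

Lemma path_adj_sym n : symmetric (@path_adj n).
Proof. by move=> i j; rewrite /path_adj /symclos orbC. Qed.
Lemma T_adj_sym k l : symmetric (@T_adj k l).
Proof. by move=> i j; rewrite /T_adj /symclos orbC. Qed.
Lemma cycle_adj_sym g : symmetric (@cycle_adj g).
Proof. by move=> i j; rewrite /cycle_adj /symclos orbC. Qed.

Lemma uniq_nbP i : uniq (nbP i).
Proof. by rewrite /nbP /= inE; lia. Qed.
Lemma uniq_nbH i : uniq (nbH i).
Proof. by rewrite /nbH; case: ifP => // _; exact: uniq_nbP. Qed.
Lemma uniq_nbT k i : uniq (nbT k i).
Proof.
rewrite /nbT; case: ifP => // _; case: ifP => _; last exact: uniq_nbP.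
by rewrite /= iota_uniq mem_iota; lia.
Qed.
Lemma uniq_nbC g i : (3 <= g)%N -> uniq (nbC g i).
Proof.
rewrite /nbC => g3; case: ifP => _; first by rewrite /= inE; lia.
by case: ifP => _; [rewrite /= !inE; lia | exact: uniq_nbP].
Qed.
Lemma uniq_nbR g i : (3 <= g)%N -> uniq (nbR g i).
Proof.
rewrite /nbR => g3; case: ifP => _; first by rewrite /= inE; lia.
by case: ifP => _; [rewrite /= !inE; lia | exact: uniq_nbP].
Qed.

Lemma lt_nbH i n a : (i.+1 < n)%N -> a \in nbH i -> (a < n)%N.
Proof. by rewrite /nbH /nbP; case: eqP => i0; rewrite ?inE; lia. Qed.
Lemma lt_nbT k i n a : (i.+1 < n)%N -> (k < n)%N -> a \in nbT k i -> (a < n)%N.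
Proof.
rewrite /nbT /nbP; case: (ltngtP i k) => ik h1 h2; rewrite !inE ?mem_iota; lia.
Qed.
Lemma lt_nbC g i n a : (g <= n)%N -> (i < n)%N -> (3 <= g)%N -> a \in nbC g i -> (a <= n)%N.
Proof.
rewrite /nbC /nbP => gn i_n g3; case: eqP => i0; [|case: eqP => ig]; rewrite ?inE; lia.
Qed.
Lemma lt_nbR g i a : (i < g)%N -> (3 <= g)%N -> a \in nbR g i -> (a < g)%N.
Proof.
rewrite /nbR /nbP => ilt g3; case: eqP => i0; [|case: eqP => ig]; rewrite ?inE; lia.
Qed.

End NeighbourLists.

(** * From neighbour lists back to the Laplacian of a graph *)

Section Transfer.
Variables (R : realType) (lam : R) (T : finType) (e : rel T).
Variables (P : nat -> T) (nb : nat -> seq nat) (i : nat).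
Hypothesis uniq_nb : uniq (map P (nb i)).
Hypothesis nbE : forall y, e (P i) y = (y \in map P (nb i)).

Lemma lapop_loceq x : lapop lam e x (P i) = loceq lam nb (fun a => x (P a)) i.
Proof. by rewrite (lapopE _ _ uniq_nb nbE) size_map big_map. Qed.

Lemma degree_nb : degree e (P i) = size (nb i).
Proof.
rewrite -(size_map P) /degree -(card_uniqP uniq_nb); apply: eq_card => y.
by rewrite inE nbE.
Qed.

End Transfer.

Section Ordinals.
Variables (n : nat) (i0 : 'I_n) (e : rel 'I_n) (nb : nat -> seq nat).

Lemma insubd_ordK (i : 'I_n) : insubd i0 (i : nat) = i.
Proof. by apply: val_inj; rewrite val_insubd ltn_ord. Qed.

Variable i : nat.
Hypothesis i_n : (i < n)%N.
Hypothesis lt_nb : forall a, a \in nb i -> (a < n)%N.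
Hypothesis uniq_nb : uniq (nb i).
Hypothesis eE : forall j : 'I_n, e (insubd i0 i) j = ((j : nat) \in nb i).

Lemma ord_uniq_nb : uniq (map (insubd i0) (nb i)).
Proof.
rewrite map_inj_in_uniq // => a b /lt_nb an /lt_nb bn /(congr1 val).
by rewrite !val_insubd an bn.
Qed.

Lemma ord_nbE (j : 'I_n) : e (insubd i0 i) j = (j \in map (insubd i0) (nb i)).
Proof.
rewrite eE; apply/idP/mapP => [ji|[a ai ->]].
  by exists (j : nat) => //; rewrite insubd_ordK.
by rewrite val_insubd (lt_nb ai).
Qed.

Lemma ord_degree : degree e (insubd i0 i) = size (nb i).
Proof. exact: (degree_nb ord_uniq_nb ord_nbE). Qed.

Lemma ord_lapop (R : realType) (lam : R) x :
  lapop lam e x (insubd i0 i) = loceq lam nb (fun a => x (insubd i0 a)) i.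
Proof. exact: (lapop_loceq _ ord_uniq_nb ord_nbE). Qed.

End Ordinals.

(** * Multiplicities for the pieces *)

Section SmallMultiplicities.
Variables (R : realType) (lam : R).

(** The value at [i1] determines a solution, so the dimension is at most 1, and [good] decides
    whether it is reached. The lists [nb] are trusted only off [S]: at a deleted last vertex they
    may run past [n]. *)
Lemma dirker_line n (i0 i1 : 'I_n) (e : rel 'I_n) (S : {set 'I_n})
    (nb : nat -> seq nat) (good : bool) (sol : nat -> R) :
  (forall i : 'I_n, uniq (nb i)) ->
  (forall i j : 'I_n, i \notin S -> e i j = ((j : nat) \in nb i)) ->
  (forall (i : 'I_n) a, i \notin S -> a \in nb i -> (a < n)%N) ->
  (forall X, (forall i : 'I_n, i \notin S -> loceq lam nb X i = 0) ->
     (forall i : 'I_n, i \in S -> X i = 0) ->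
     (~~ good -> X i1 = 0) /\ (X i1 = 0 -> forall i : 'I_n, X i = 0)) ->
  (good -> sol i1 = 1 /\ forall i : 'I_n,
     if i \in S then sol i = 0 else loceq lam nb sol i = 0) ->
  \dim (dirker lam e S) = good.
Proof.
move=> u eE lt h hsol.
have lapE (x : {ffun 'I_n -> R^o}) (i : 'I_n) : i \notin S ->
    lapop lam e x i = loceq lam nb (fun a => x (insubd i0 a)) i.
  move=> iS; rewrite -{1}(insubd_ordK i0 i); apply: ord_lapop => //.
    by move=> a; apply: lt.
  by move=> j; rewrite insubd_ordK eE.
apply/eqP; rewrite eqn_leq; apply/andP; split.
  have -> : (good : nat) = #|if good then [set: unit] else set0|.
    by case: (good); rewrite ?cardsT ?card_unit ?cards0.
  apply: (@dim_le_evals _ _ _ _ (fun=> i1)) => x /dirkerP[x0 xe] xi1.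
  have [] := h (fun a => x (insubd i0 a)).
  - by move=> i iS; rewrite -lapE ?xe.
  - by move=> i iS; rewrite insubd_ordK x0.
  rewrite insubd_ordK => h1 h2; apply/ffunP=> i; rewrite ffunE.
  rewrite -[i](insubd_ordK i0) h2 //.
  by move: xi1 h1; case: (good) => [/(_ tt) -> //|_ -> //]; rewrite inE.
case: (boolP good) hsol => // _ /(_ isT) [s1 s].
have -> : (true : nat) = #|[set: unit]| by rewrite cardsT card_unit.
apply: (@dim_ge_evals _ _ _ _ (fun=> i1)) => c _.
exists [ffun i : 'I_n => c tt * sol i]; last by move=> [] _; rewrite ffunE s1 mulr1.
apply/dirkerP; split=> i iS; first by have := s i; rewrite iS ffunE => ->; rewrite mulr0.
have := s i; rewrite lapE // (negbTE iS) => si.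
transitivity (c tt * loceq lam nb sol i); last by rewrite si mulr0.
rewrite /loceq mulrBr big_distrr /= ffunE insubd_ordK; congr (_ - _); first by ring.
apply: eq_big_seq => a /(lt _ _ iS) an.
by rewrite ffunE val_insubd an.
Qed.

Lemma mult_Umx t : mult (Umx R t) lam = (chain lam 0 1 t.+1 == 0).
Proof.
rewrite /Umx (@mult_laplacian_del _ _ _ _ _ id) //; last exact: path_adj_sym.
have S0 (i : 'I_t.+2) : (i \in [set x | id x \in [set ord0; ord_max]]) =
    (i == 0%N :> nat) || (i == t.+1 :> nat).
  by rewrite !inE -!(inj_eq val_inj).
apply: (@dirker_line _ ord0 (inord 1) _ _ nbH _ (chain lam 0 1)).
- by move=> i; exact: uniq_nbH.
- by move=> i j _; exact: path_adj_nbH.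
- move=> i a; rewrite S0 => iS; apply: lt_nbH.
  by have := ltn_ord i; lia.
- move=> X Xe X0.
  have X00 : X 0%N = 0 by apply: (X0 ord0); rewrite S0.
  have Xt : X t.+1 = 0 by apply: (X0 ord_max); rewrite S0 eqxx orbT.
  have uni : forall n, (n <= t.+1)%N -> X n = X 1%N * chain lam 0 1 n.
    have := @path_uniq _ lam t X; rewrite X00 => uni n nt.
    rewrite -chain_scale mulr0 mulr1; apply: uni => // i it.
    have := Xe (inord i.+1); rewrite S0 inordK; last by lia.
    by apply; lia.
  rewrite inordK //; split=> [bad|X1 i]; last by rewrite uni ?X1 ?mul0r // -ltnS.
  by move/eqP: (uni t.+1 (leqnn _)); rewrite Xt eq_sym mulf_eq0 (negbTE bad) orbF => /eqP.
- move=> /eqP good; rewrite inordK //; split=> // i; rewrite S0.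
  case: ifP => [/orP[/eqP->|/eqP->]|] //.
  by case: (nat_of_ord i) => // a _; exact: path_sol.
Qed.

Lemma mult_Bmx k l : lam != 1 -> (0 < k)%N -> (0 < l)%N ->
  mult (Bmx R k l) lam = (starchain lam k l == 0).
Proof.
move=> lam1 k0 l0.
rewrite /Bmx (@mult_laplacian_del _ _ _ _ _ id) //; last exact: T_adj_sym.
have S0 (i : 'I_(k + l.+1)) :
    (i \in [set x | id x \in [set i : 'I_(k + l.+1) | i == (k + l)%N :> nat]]) =
    (i == (k + l)%N :> nat).
  by rewrite !inE.
have kl : (k < k + l.+1)%N by lia.
have kl' : (k + l < k + l.+1)%N by lia.
apply: (@dirker_line _ (Ordinal kl) (Ordinal kl) _ _ (nbT k) _ (solT lam k 1)).
- by move=> i; exact: uniq_nbT.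
- by move=> i j _; exact: T_adj_nbT.
- move=> i a; rewrite S0 => iS; apply: lt_nbT => //.
  by have := ltn_ord i; lia.
- move=> X Xe X0.
  have Xt : X (k + l)%N = 0 by apply: (X0 (Ordinal kl')); rewrite S0.
  have uni : forall n, (n <= k + l)%N -> X n = solT lam k (X k) n.
    apply: star_uniq => // i it.
    have il : (i < k + l.+1)%N by lia.
    by apply: (Xe (Ordinal il)); rewrite S0 /=; lia.
  split=> /= [bad|X1 i]; last first.
    rewrite (uni i); last by have := ltn_ord i; lia.
    by rewrite /solT X1 !mul0r if_same.
  have /eqP := uni _ (leqnn _); rewrite Xt /solT ifF; last by lia.
  by rewrite addKn eq_sym mulf_eq0 (negbTE bad) orbF => /eqP.
- move=> /eqP good /=; split; first by rewrite /solT ltnn subnn mulr1.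
  move=> i; rewrite S0; case: eqP => [->|_]; last exact: star_sol.
  by rewrite /solT ifF ?addKn ?good ?mulr0 //; lia.
Qed.

(** The single vertex of P_1 has degree 0, hence the condition [1 < h]. *)
Lemma path_pendant h (v : 'I_h) : pendant (@path_adj h) v =
  (1 < h)%N && ((v == 0%N :> nat) || (v == h.-1 :> nat)).
Proof.
rewrite /pendant; have vh := ltn_ord v.
have deg (nb : nat -> seq nat) : (forall a, a \in nb v -> (a < h)%N) -> uniq (nb v) ->
    (forall j : 'I_h, path_adj v j = ((j : nat) \in nb v)) ->
    degree (@path_adj h) v = size (nb v).
  move=> l u s; rewrite -{1}(insubd_ordK v v); apply: ord_degree => //.
  by move=> j; rewrite insubd_ordK.
have [h1|h1] := leqP h 1.
  rewrite (deg (fun=> [::])) //= => j; rewrite path_adj_nbH.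
  have -> : nat_of_ord v = 0%N by lia.
  by have := ltn_ord j; rewrite /nbH /= inE in_nil; move: (nat_of_ord j) => a; lia.
have [v0|v0] := eqVneq (v : nat) 0%N.
  rewrite (deg nbH) //; first by rewrite /nbH v0.
  - by move=> a; rewrite /nbH v0 inE; lia.
  - exact: uniq_nbH.
  - exact: path_adj_nbH.
have [v1|v1] := eqVneq (v : nat) h.-1.
  rewrite (deg (fun=> [:: v.-1])) //.
  - by move=> a; rewrite inE; lia.
  - by move=> j; have := ltn_ord j; rewrite path_adj_nbH /nbH (negbTE v0) /nbP !inE; lia.
rewrite (deg nbH) //; first by rewrite /nbH (negbTE v0).
- by move=> a; apply: lt_nbH; lia.
- exact: uniq_nbH.
- exact: path_adj_nbH.
Qed.

(** A free end behaves as if preceded by a ghost vertex with the same value. Counting the ghost as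
    position 0, the deleted end has position [h]. *)
Lemma mult_path_del h (v : 'I_h) : pendant (@path_adj h) v ->
  mult (laplacian_del R (@path_adj h) [set v]) lam = (chain lam 1 1 h == 0).
Proof.
rewrite path_pendant => /andP[h1 vE].
(* Reversal makes the deleted end the last vertex. *)
pose s (i : 'I_h) := if v == 0%N :> nat then rev_ord i else i.
have sK : involutive s by move=> i; rewrite /s; case: eqP => // _; exact: rev_ordK.
rewrite (@mult_laplacian_del _ _ _ _ _ s) //; first last.
- move=> i j; rewrite /s; case: eqP => // _; rewrite /path_adj /symclos /=.
  by have := ltn_ord i; have := ltn_ord j; lia.
- exact: path_adj_sym.
have S0 (i : 'I_h) : (i \in [set x | s x \in [set v]]) = (i == h.-1 :> nat).
  rewrite !inE -(inj_eq val_inj) /s; have := ltn_ord i; move: vE; case: eqP => v0 vE /=; rewrite ?v0; lia.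
have h0 : (0 < h)%N by lia.
have hh : (h.-1 < h)%N by lia.
have -> : chain lam 1 1 h = chain lam 1 (1 - lam) h.-1.
  by rewrite -{1}(prednK h0) chain_shift; congr chain; ring.
apply: (@dirker_line _ (Ordinal h0) (Ordinal h0) _ _ nbH _ (chain lam 1 (1 - lam))).
- by move=> i; exact: uniq_nbH.
- by move=> i j _; exact: path_adj_nbH.
- by move=> i a; rewrite S0 => iS; apply: lt_nbH; have := ltn_ord i; lia.
- move=> X Xe X0.
  have Xt : X h.-1 = 0 by apply: (X0 (Ordinal hh)); rewrite S0.
  have uni : forall n, (n <= h.-1)%N -> X n = X 0%N * chain lam 1 (1 - lam) n.
    apply: half_uniq => i it; have il : (i < h)%N by lia.
    by apply: (Xe (Ordinal il)); rewrite S0 /=; lia.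
  split=> /= [bad|X1 i]; last first.
    by rewrite uni ?X1 ?mul0r //; have := ltn_ord i; lia.
  have /eqP := uni _ (leqnn _); rewrite Xt.
  by rewrite eq_sym mulf_eq0 (negbTE bad) orbF => /eqP.
- move=> /eqP good /=; split=> // i.
  by rewrite S0; case: eqP => [->//|_]; exact: half_sol.
Qed.

(** The values at 0 and [g.-1] determine a solution. They are both free when the transfer matrix is
    the identity; otherwise [ring_bad] makes one determine the other. *)
Lemma mult_cycle_eq2 g : (3 <= g)%N ->
  mult (laplacian R (@cycle_adj g)) lam = 2%N <-> cyc_good lam g.
Proof.
move=> g3; rewrite mult_laplacian; last exact: cycle_adj_sym.
have g0 : (0 < g)%N by lia.
have g1 : (g.-1 < g)%N by lia.
pose o0 := Ordinal g0; pose o1 := Ordinal g1.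
have lapE (x : {ffun 'I_g -> R^o}) (i : 'I_g) :
    lapop lam (@cycle_adj g) x i = loceq lam (nbR g) (fun a => x (insubd o0 a)) i.
  rewrite -{1}(insubd_ordK o0 i); apply: ord_lapop => //.
  - by move=> a; apply: lt_nbR.
  - exact: uniq_nbR.
  - by move=> j; rewrite insubd_ordK cycle_adj_nbR.
pose ev (b : bool) := if b then o1 else o0.
have evE b : insubd o0 (if b then g.-1 else 0%N) = ev b.
  by apply: val_inj; rewrite val_insubd; case: b; rewrite ?g1 ?g0.
have e0 : insubd o0 0%N = o0 := evE false.
have e1 : insubd o0 g.-1 = o1 := evE true.
have red (x : {ffun 'I_g -> R^o}) : x \in dirker lam (@cycle_adj g) set0 ->
    x o1 = 0 -> x o0 = 0 -> x = 0.
  case/dirkerP=> _ xe x1 x0.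
  have [|arc _] := @ring_arc _ lam g (fun a => x (insubd o0 a)) g3.
    by move=> i ig; rewrite -(lapE x (Ordinal ig)) xe ?inE.
  apply/ffunP=> i; rewrite ffunE -[i](insubd_ordK o0) arc //.
  by rewrite e0 e1 x0 x1 chain_00.
split=> [d2|good].
  apply/negPn/negP=> bad; suff : (\dim (dirker lam (@cycle_adj g) set0) <= 1)%N by rewrite d2.
  (* The index [true] stands for vertex [g.-1]; the one index kept is that of the determining
     coordinate in [ring_bad]. *)
  rewrite -(cards1 (chain lam 0 1 g != 0)).
  apply: (@dim_le_evals _ _ _ _ ev) => x xD /(_ _ (set11 _)) hx.
  have /dirkerP[_ xe] := xD.
  have := @ring_bad _ lam g (fun a => x (insubd o0 a)) g3 bad.
  rewrite e0 e1 /= => /(_ _) hb.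
  have {}hb := hb (fun i ig => etrans (esym (lapE x (Ordinal ig))) (xe _ ltac:(by rewrite inE))).
  by move: hb hx; case: ifP => _ /= hb hx; apply: red => //; exact: hb.
apply/eqP; rewrite eqn_leq; apply/andP; split.
  have <- : #|[set: bool]| = 2%N by rewrite cardsT card_bool.
  apply: (@dim_le_evals _ _ _ _ ev) => x xD hx.
  by apply: red => //; [apply: (hx true) | apply: (hx false)]; rewrite inE.
have <- : #|[set: bool]| = 2%N by rewrite cardsT card_bool.
apply: (@dim_ge_evals _ _ _ _ ev) => c _.
have [cg _] := cyc_good_chain (c true) (c false) good.
exists [ffun i : 'I_g => chain lam (c true) (c false) i.+1]; last first.
  case=> _; rewrite ffunE; last by [].
  by rewrite [nat_of_ord _]/(g.-1) prednK.
apply/dirkerP; split=> i; rewrite inE // => _; rewrite lapE.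
rewrite -[RHS](@ring_sol _ lam g (c false) (c true) i) //; apply: eq_loceq.
  by rewrite ffunE insubd_ordK.
by move=> a /lt_nbR ag; rewrite ffunE val_insubd ag.
Qed.

End SmallMultiplicities.

(** * Edge counts in a tree *)

Section Skeleton.
Variables (T J : finType) (V : {set T}) (u w : J -> T).

Definition inner (W : {set T}) : {set J} := [set j | (u j \in W) && (w j \in W)].

Hypothesis crossing : forall W : {set T}, W \subset V -> W != set0 -> W != V ->
  exists j, (u j \in W) != (w j \in W).
Hypothesis uV : forall j, u j \in V.
Hypothesis wV : forall j, w j \in V.

(** Grow [W] to [V] one vertex at a time along crossing edges: each step makes at least one more
    edge inner. *)
Lemma outer_edges (W : {set T}) : W \subset V -> W != set0 ->
  (#|V| <= #|W| + #|~: inner W|)%N.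
Proof.
have [n] := ubnP (#|V| - #|W|); elim: n W => // n IH W nW WV W0.
have [->|WneqV] := eqVneq W V; first exact: leq_addr.
have [j jW] := crossing WV W0 WneqV.
pose v := if u j \in W then w j else u j.
have vV : v \in V by rewrite /v; case: ifP.
have vW : v \notin W by move: jW; rewrite /v; case: (boolP (u j \in W)); case: (w j \in W).
have ltW : (#|W| < #|V|)%N by rewrite proper_card // properEneq WneqV.
have cW : #|v |: W| = #|W|.+1 by rewrite cardsU1 vW.
have W'V : v |: W \subset V by rewrite subUset sub1set vV.
have := IH (v |: W) _ W'V _; rewrite cW => IH'.
have {}IH : (#|V| <= #|W|.+1 + #|~: inner (v |: W)|)%N.
  apply: IH'; first by lia.
  by apply/set0Pn; exists v; rewrite setU11.
suff : (#|~: inner (v |: W)| < #|~: inner W|)%N by lia.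
apply: proper_card; apply/properP; split.
  rewrite setCS; apply/subsetP=> i; rewrite !inE => /andP[-> ->].
  by rewrite !orbT.
by exists j; move: jW; rewrite /v !inE; case: (u j \in W); case: (w j \in W);
  rewrite //= ?eqxx ?orbT.
Qed.

Hypothesis cardJ : (#|J| + 1 = #|V|)%N.

(** A connected graph with |V| - 1 edges is a tree, and its induced subgraphs are forests. *)
Lemma inner_lt (W : {set T}) : W \subset V -> W != set0 -> (#|inner W| < #|W|)%N.
Proof.
move=> WV W0; have := outer_edges WV W0.
have := cardsC (inner W); lia.
Qed.

Lemma incidence_sum (S : {set J}) (W : {set T}) : S \subset inner W ->
  (\sum_(v in W) \sum_(j in S) ((u j == v) + (w j == v)) = 2 * #|S|)%N.
Proof.
move=> SW; rewrite exchange_big /= -[RHS]mulnC -sum_nat_const.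
apply: eq_bigr => j /(subsetP SW); rewrite inE => /andP[uW wW].
rewrite big_split /= (bigD1 (u j)) //= eqxx big1 => [|v /andP[_ /negbTE]]; last first.
  by rewrite eq_sym => ->.
rewrite (bigD1 (w j)) //= eqxx big1 // => v /andP[_ /negbTE].
by rewrite eq_sym => ->.
Qed.

Hypothesis uw : forall j, u j != w j.

(* A linear dependency between the functionals of the edges in Q would be     *)
(* supported on a subgraph of minimum degree 2, which a forest does not have. *)
Lemma edge_functionals_dim (R : realType) (Y : {vspace {ffun T -> R^o}})
    (U : {set T}) (Q : {set J}) (b : J -> R) :
  U \subset V -> Q \subset inner U -> (forall j, j \in Q -> b j != 0) ->
  (forall y v, y \in Y -> v \notin U -> y v = 0) ->
  (forall y j, y \in Y -> j \in Q -> y (u j) + b j * y (w j) = 0) ->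
  (\dim Y + #|Q| <= #|U|)%N.
Proof.
move=> UV QU b0 Y0 YQ.
pose th (c : 'rV[R]_#|Q|) : {ffun T -> R^o} :=
  [ffun v => \sum_(i < #|Q|) c 0 i * ((u (enum_val i) == v)%:R +
     b (enum_val i) * (w (enum_val i) == v)%:R)].
have thlin : linear th.
  move=> a c d; apply/ffunP=> v; rewrite !ffunE.
  rewrite [X in _ = X + _]scaler_sumr -big_split /=; apply: eq_bigr => i _.
  by rewrite !mxE mulrDl /GRing.scale /= mulrA.
pose thL : {linear 'rV[R]_#|Q| -> {ffun T -> R^o}} :=
  HB.pack th (GRing.isLinear.Build R 'rV[R]_#|Q| {ffun T -> R^o} _ th thlin).
have thE c v : th c v = \sum_(j in Q) (if [pick i | enum_val i == j] is Some i then c 0 i else 0)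
    * ((u j == v)%:R + b j * (w j == v)%:R).
  rewrite ffunE [RHS]big_enum_val /=; apply: eq_bigr => i _.
  by case: pickP => [i' /eqP/enum_val_inj -> //|/(_ i)]; rewrite eqxx.
have injth c : th c = 0 -> c = 0.
  move=> th0; apply/rowP=> i; rewrite mxE; apply/eqP/negPn/negP=> ci0.
  pose C j := if [pick i | enum_val i == j] is Some i then c 0 i else 0.
  pose S := [set j in Q | C j != 0].
  pose W := [set v | [exists j in S, (u j == v) || (w j == v)]].
  have SW : S \subset inner W.
    apply/subsetP=> j jS; rewrite !inE.
    by apply/andP; split; apply/exists_inP; exists j => //; rewrite eqxx ?orbT.
  have WV : W \subset V.
    apply/subsetP=> v; rewrite inE => /exists_inP[j _ /orP[] /eqP <-] //.
  have iS : enum_val i \in S.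
    rewrite inE enum_valP /= /C; case: pickP => [i' /eqP/enum_val_inj -> //|/(_ i)].
    by rewrite eqxx.
  have W0 : W != set0.
    apply/set0Pn; exists (u (enum_val i)); rewrite inE; apply/exists_inP.
    by exists (enum_val i); rewrite ?eqxx.
  have := inner_lt WV W0; have := subset_leq_card SW.
  (* If every vertex of [W] meets two edges of [S], then |W| <= |S| <= |inner W|, against
     [inner_lt]. *)
  suff : (#|W| * 2 <= 2 * #|S|)%N by lia.
  rewrite -(incidence_sum SW) -sum_nat_const; apply: leq_sum => v.
  rewrite inE => /exists_inP[j jS jv]; have := jS; rewrite inE => /andP[jQ Cj].
  (* If [v] met [j] only, [th c v] would be [C j] times 1 or [b j], which is nonzero. *)
  rewrite (bigD1 j) //= leqNgt; apply/negP=> lt2.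
  have /eqP rest0 : (\sum_(i0 in S | i0 != j) ((u i0 == v) + (w i0 == v)) == 0)%N.
    by move: lt2 jv; case: (u j == v); case: (w j == v) => //=; lia.
  have : th c v = 0 by rewrite th0 ffunE.
  rewrite thE (bigD1 j) //= big1 => [|j' /andP[j'Q j'j]].
    rewrite addr0 -/(C j) => /eqP; rewrite mulf_eq0 (negbTE Cj) /=.
    case: (u j =P v) jv => [uv _|_ /= ->]; last first.
      by rewrite add0r mulr1 (negbTE (b0 _ jQ)).
    have -> : (w j == v) = false by rewrite -uv eq_sym (negbTE (uw j)).
    by rewrite mulr0 addr0 oner_eq0.
  rewrite -/(C j'); have [->|Cj'] := eqVneq (C j') 0; first by rewrite mul0r.
  move/eqP: rest0; rewrite sum_nat_eq0 => /forall_inP/(_ j').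
  rewrite inE j'Q Cj' j'j => /(_ isT).
  by case: (u j' == v); case: (w j' == v) => //= _; rewrite mulr0 addr0 mulr0.
have dth : \dim (linfun thL @: fullv) = #|Q|.
  rewrite limg_dim_eq ?dim_rVf //; apply/eqP; rewrite -subv0; apply/subvP=> c.
  by rewrite memv_cap memv_ker lfunE memv0 => /andP[_ /eqP/injth ->].
rewrite -dth addnC; apply: orthogonal_dim_le => //.
- move=> _ y /memv_imgP[c _ ->] yY; rewrite lfunE /=.
  transitivity (\sum_v \sum_(i < #|Q|) c 0 i * ((u (enum_val i) == v)%:R +
     b (enum_val i) * (w (enum_val i) == v)%:R) * y v).
    by apply: eq_bigr => v _; rewrite ffunE mulr_suml.
  rewrite exchange_big big1 //= => i _.
  transitivity (c 0 i * (y (u (enum_val i)) + b (enum_val i) * y (w (enum_val i)))).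
    transitivity (c 0 i * (\sum_v (u (enum_val i) == v)%:R * y v +
        b (enum_val i) * \sum_v (w (enum_val i) == v)%:R * y v)).
      rewrite mulr_sumr -big_split /= mulr_sumr; apply: eq_bigr => v _; ring.
    have delta z : \sum_v (z == v)%:R * y v = y z.
      rewrite (bigD1 z) //= eqxx mul1r big1 ?addr0 // => v /negbTE.
      by rewrite eq_sym => ->; rewrite mul0r.
    by rewrite !delta.
  by rewrite YQ ?enum_valP ?mulr0.
- move=> _ v /memv_imgP[c _ ->] vU; rewrite lfunE /= ffunE big1 // => i _.
  have := subsetP QU _ (enum_valP i); rewrite inE => /andP[uU wU].
  have -> : (u (enum_val i) == v) = false by apply: contraNF vU => /eqP <-.
  have -> : (w (enum_val i) == v) = false by apply: contraNF vU => /eqP <-.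
  by rewrite mulr0 addr0 mulr0.
Qed.

End Skeleton.

(** * Decomposed graphs *)

Section PendantPiece.
Variables (T : finType) (e : rel T) (n : nat) (p : 'I_n -> T) (w : T).
Variables (r : rel 'I_n) (nb : nat -> seq nat).

(* The piece together with its attachment vertex, which gets number n. *)
Definition extend_piece (a : nat) : T := if insub a is Some i then p i else w.

Lemma extend_piece_ord (i : 'I_n) : extend_piece i = p i.
Proof. by rewrite /extend_piece valK. Qed.

Lemma extend_piece_lt a (an : (a < n)%N) : extend_piece a = p (Ordinal an).
Proof. by rewrite /extend_piece insubT. Qed.

Lemma extend_piece_ge a : (n <= a)%N -> extend_piece a = w.
Proof. by move=> na; rewrite /extend_piece insubF // ltnNge na. Qed.

Lemma extend_piece_last : extend_piece n = w.
Proof. exact: extend_piece_ge. Qed.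

Hypothesis p_inj : injective p.
Hypothesis w_p : w \notin codom p.

Lemma extend_piece_inj a b : (a <= n)%N -> (b <= n)%N ->
  extend_piece a = extend_piece b -> a = b.
Proof.
have aux c : (c < n)%N -> extend_piece c <> extend_piece n.
  move=> cn; rewrite extend_piece_lt extend_piece_last => pw.
  by move/negP: w_p; apply; rewrite -pw codom_f.
rewrite leq_eqVlt => /orP[/eqP->|an]; rewrite leq_eqVlt => /orP[/eqP->|bn] //.
- by move/esym/aux => /(_ bn).
- by move/aux => /(_ an).
- by rewrite !extend_piece_lt => /p_inj [].
Qed.

Hypothesis rE : forall i j, e (p i) (p j) = r i j.
Hypothesis joined : forall (x : 'I_n) y, y \notin codom p ->
  e (p x) y = (x.+1 == n) && (y == w).
Hypothesis r_nb : forall i j, r i j = ((j : nat) \in nb i).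
Hypothesis nb_le : forall i a, (i < n)%N -> a \in nb i -> (a <= n)%N.
Hypothesis nb_last : forall i, (i < n)%N -> (n \in nb i) = (i.+1 == n).
Hypothesis nb_uniq : forall i, uniq (nb i).

Lemma extend_piece_uniq i : (i < n)%N -> uniq (map extend_piece (nb i)).
Proof.
move=> i_n; rewrite map_inj_in_uniq // => a b /(nb_le i_n) an /(nb_le i_n) bn.
exact: extend_piece_inj.
Qed.

(** Neighbours inside the piece come from [r_nb]; the only edge leaving it is recorded by the number
    [n] in the list of the last vertex. *)
Lemma extend_piece_nb i y : (i < n)%N ->
  e (extend_piece i) y = (y \in map extend_piece (nb i)).
Proof.
move=> i_n; rewrite (extend_piece_lt i_n).
have [/codomP[j ->]|yp] := boolP (y \in codom p).
  rewrite rE r_nb /=; apply/idP/mapP => [ji|[a ai]].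
    by exists (j : nat) => //; rewrite extend_piece_ord.
  by rewrite -extend_piece_ord => /extend_piece_inj -> //; [exact: ltnW | exact: nb_le ai].
rewrite joined // -nb_last //; apply/andP/mapP => [[ni /eqP->]|[a ai ya]].
  by exists n => //; rewrite extend_piece_last.
have an := nb_le i_n ai; have [alt|] := ltnP a n.
  by move: yp; rewrite ya extend_piece_lt codom_f.
move=> na; have {}an : a = n by lia.
by rewrite an in ai ya; rewrite ai ya extend_piece_last eqxx.
Qed.

Lemma extend_piece_lapop (R : realType) (lam : R) x i : (i < n)%N ->
  lapop lam e x (extend_piece i) = loceq lam nb (fun a => x (extend_piece a)) i.
Proof.
move=> i_n; apply: lapop_loceq; first exact: extend_piece_uniq.
by move=> y; exact: extend_piece_nb.
Qed.

(** As [y] vanishes on the piece, [lapop y] there sees only the joining edge: it is [- y w] at the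
    last vertex and 0 elsewhere. *)
Lemma extend_piece_flux (R : realType) (lam : R) (y : {ffun T -> R^o}) (s : nat -> R) : (0 < n)%N ->
  (forall a, (a < n)%N -> y (extend_piece a) = 0) ->
  \sum_(i < n) lapop lam e y (p i) * s i = - (y w * s n.-1).
Proof.
move=> n0 y0; have n1 : (n.-1 < n)%N by rewrite prednK.
rewrite (bigD1 (Ordinal n1)) //=.
have lapE (i : 'I_n) : lapop lam e y (p i) = - (y w *+ (i.+1 == n)).
  have i_n := ltn_ord i.
  rewrite -extend_piece_ord extend_piece_lapop // /loceq y0 // mulr0 sub0r.
  congr (- _); rewrite -nb_last //.
  have ylt a : a \in nb i -> a != n -> y (extend_piece a) = 0.
    by move=> /(nb_le i_n) an an'; rewrite y0 //; lia.
  case: (boolP (n \in nb i)) => [ni|ni].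
    rewrite (bigD1_seq n) //= extend_piece_last big_seq_cond big1 ?addr0 // => a.
    by case/andP; exact: ylt.
  rewrite big_seq big1 // => a ai; apply: ylt => //.
  by apply/eqP => an; rewrite an in ai; rewrite ai in ni.
rewrite lapE /= prednK // eqxx mulr1n mulNr big1 ?addr0 // => i ni.
rewrite lapE (_ : (i.+1 == n) = false) ?mulr0n ?oppr0 ?mul0r //.
by apply: contraNF ni => /eqP i1; apply/eqP/val_inj; rewrite /= -[in RHS]i1.
Qed.

End PendantPiece.

Lemma card_set_sum (A : finType) (P : pred A) : #|[set x | P x]| = (\sum_x P x)%N.
Proof.
by rewrite -sum1_card big_mkcond; apply: eq_bigr => x _; rewrite inE; case: (P x).
Qed.

Section PieceSum.
Variables (R : realType) (T : finType) (n : nat) (p : 'I_n -> T).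

Lemma sum_piece (F : T -> R) : injective p ->
  (forall v, v \notin codom p -> F v = 0) -> \sum_v F v = \sum_(i < n) F (p i).
Proof.
move=> pinj F0; rewrite (bigID [in codom p]) /= [X in _ + X]big1 ?addr0 //.
have up : uniq (codom p) by rewrite map_inj_uniq ?enum_uniq.
by rewrite -big_uniq //= big_map big_enum.
Qed.

End PieceSum.

(* bC, bT, bP count the violated conditions, U the support of Y, i the edges  *)
(* inside U and Q those of them satisfying their condition.                   *)
Lemma deficiency_count dE G dK dY bC bT bP fr X np i U Q uu ww sC sT :
  (dE + G <= dK + 2 * dY -> dK <= fr -> fr + bC + bT + bP = X + np -> np + 1 = G ->
   dY + Q <= U -> uu + ww <= i + bP + Q -> sC <= bC -> sT <= bT ->
   3 * U <= sC + sT + (uu + ww) -> (0 < U -> i < U) ->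
   dE + 1 <= X /\ (0 < bC + bT + bP -> dE + 2 <= X))%N.
Proof. by case: U => [|U] *; lia. Qed.

(** * The pieces of a decomposed graph and their equations *)

Section Decomposed.
Variables (R : realType) (lam : R) (T : finType) (e : rel T).
Hypothesis e_sym : symmetric e.
Hypothesis e_conn : connected e.
Hypothesis lam1 : lam != 1.
Variables (g h : 'I_(cyclomatic e) -> nat).
Variables (k l : 'I_(num_quasi_pendant e) -> nat).
Variable (t : 'I_(#|Gamma e| - 1) -> nat).
Variable f : CG g h + TG k l + PG t -> T.
Variables (u w : 'I_(#|Gamma e| - 1) -> T).
Hypothesis dec : decomposition f u w.
Variables (wC : 'I_(cyclomatic e) -> T) (wT : 'I_(num_quasi_pendant e) -> T).
Hypothesis wCG : forall m, wC m \in Gamma e.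
Hypothesis wTG : forall i, wT i \in Gamma e.
Hypothesis wCE : forall m (x : 'I_(g m + h m - 1)) y, y \notin codom (@C_piece _ _ _ _ _ _ _ f m) ->
  e (C_piece f x) y = (x.+1 == g m + h m - 1)%N && (y == wC m).
Hypothesis wTE : forall i (x : 'I_(k i + l i)) y, y \notin codom (@T_piece _ _ _ _ _ _ _ f i) ->
  e (T_piece f x) y = (x.+1 == k i + l i)%N && (y == wT i).

Local Notation c := (cyclomatic e).
Local Notation q := (num_quasi_pendant e).
Local Notation np := (#|Gamma e| - 1)%N.

Let pC m := @C_piece _ _ g h k l t f m.
Let pT i := @T_piece _ _ g h k l t f i.
Let pP j := @P_piece _ _ g h k l t f j.

Let g3 m : (3 <= g m)%N := (dec_C_param dec m).1.
Let h1 m : (1 <= h m)%N := (dec_C_param dec m).2.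
Let k1 i : (1 <= k i)%N := (dec_T_param dec i).1.
Let l1 i : (1 <= l i)%N := (dec_T_param dec i).2.

Lemma f_notin z : f z \notin Gamma e.
Proof. by have := dec_codom dec (f z); rewrite codom_f inE => <-. Qed.

Lemma notin_f v : v \notin Gamma e -> exists z, v = f z.
Proof. by move=> vG; apply/codomP; rewrite (dec_codom dec) inE. Qed.

Lemma pC_inj m : injective (@pC m).
Proof.
move=> x y /(Defs.dec_inj dec) E.
have := congr1 (fun z => if z is inl (inl s)
  then s == Tagged (fun m => 'I_(g m + h m - 1)) y else true) E.
by rewrite eqxx eq_Tagged => /eqP.
Qed.

Lemma pT_inj i : injective (@pT i).
Proof.
move=> x y /(Defs.dec_inj dec) E.
have := congr1 (fun z => if z is inl (inr s)
  then s == Tagged (fun i => 'I_(k i + l i)) y else true) E.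
by rewrite eqxx eq_Tagged => /eqP.
Qed.

Lemma pP_inj j : injective (@pP j).
Proof.
move=> x y /(Defs.dec_inj dec) E.
have := congr1 (fun z => if z is inr s then s == Tagged (fun j => 'I_(t j)) y else true) E.
by rewrite eqxx eq_Tagged => /eqP.
Qed.

Lemma wC_pC m : wC m \notin codom (@pC m).
Proof. by apply: contraL (wCG m) => /codomP[x ->]; exact: f_notin. Qed.

Lemma wT_pT i : wT i \notin codom (@pT i).
Proof. by apply: contraL (wTG i) => /codomP[x ->]; exact: f_notin. Qed.

Lemma pC_adj m x y : e (@pC m x) (@pC m y) = C_adj x y.
Proof. by rewrite (dec_adj dec) /= /family_adj /= eqxx tagged_asE. Qed.

Lemma pT_adj i x y : e (@pT i x) (@pT i y) = T_adj x y.
Proof. by rewrite (dec_adj dec) /= /family_adj /= eqxx tagged_asE. Qed.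

Definition PC m := extend_piece (@pC m) (wC m).
Definition PT i := extend_piece (@pT i) (wT i).
(** Position 0 is [u j], the path occupies 1 to [t j], and the default value of [nth] supplies [w j]
    from [(t j).+1] on. *)
Definition PP j a := nth (w j) (u j :: codom (@pP j)) a.

Let nC m := (g m + h m - 1)%N.

Lemma nbC_le m i a : (i < nC m)%N -> a \in nbC (g m) i -> (a <= nC m)%N.
Proof.
by have := g3 m; have := h1 m => hm gm ic; apply: lt_nbC => //; rewrite /nC; lia.
Qed.

Lemma nbC_last m i : (i < nC m)%N -> (nC m \in nbC (g m) i) = (i.+1 == nC m).
Proof.
have := g3 m; have := h1 m; rewrite /nbC /nbP /nC => hm gm ic.
by case: eqP => i0; [|case: eqP => i1]; rewrite !inE; lia.
Qed.

Lemma nbT_le i a b : (a < k i + l i)%N -> b \in nbT (k i) a -> (b <= k i + l i)%N.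
Proof.
by have := k1 i; have := l1 i => li ki al; rewrite -ltnS; apply: lt_nbT; lia.
Qed.

Lemma nbT_last i a : (a < k i + l i)%N ->
  ((k i + l i)%N \in nbT (k i) a) = (a.+1 == k i + l i)%N.
Proof.
have := k1 i; have := l1 i; rewrite /nbT /nbP => li ki al.
by case: (ltngtP a (k i)) => ak; rewrite !inE ?mem_iota; lia.
Qed.

Lemma PC_nb m i y : (i < nC m)%N -> e (PC m i) y = (y \in map (PC m) (nbC (g m) i)).
Proof.
apply: (extend_piece_nb (@pC_inj m) (wC_pC m) (@pC_adj m)) => //.
- exact: wCE.
- by move=> a b; apply: C_adj_nbC.
- by move=> a b; exact: nbC_le.
- by move=> a; exact: nbC_last.
Qed.

Lemma PC_lapop x m i : (i < nC m)%N ->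
  lapop lam e x (PC m i) = loceq lam (nbC (g m)) (fun a => x (PC m a)) i.
Proof.
move=> ic.
apply: (extend_piece_lapop (@pC_inj m) (wC_pC m) (@pC_adj m)) => //.
- exact: wCE.
- by move=> a b; apply: C_adj_nbC.
- by move=> a b; exact: nbC_le.
- by move=> a; exact: nbC_last.
- by move=> a; exact: uniq_nbC.
Qed.

Lemma PC_flux m (y : {ffun T -> R^o}) (s : nat -> R) : (forall a, (a < nC m)%N -> y (PC m a) = 0) ->
  \sum_(i < nC m) lapop lam e y (@pC m i) * s i = - (y (wC m) * s (nC m).-1).
Proof.
apply: (extend_piece_flux (@pC_inj m) (wC_pC m) (@pC_adj m)) => //.
- exact: wCE.
- by move=> a b; apply: C_adj_nbC.
- by move=> a b; exact: nbC_le.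
- by move=> a; exact: nbC_last.
- by move=> a; exact: uniq_nbC.
- by rewrite /nC; have := g3 m; have := h1 m; lia.
Qed.

Lemma PT_nb m i y : (i < k m + l m)%N -> e (PT m i) y = (y \in map (PT m) (nbT (k m) i)).
Proof.
apply: (extend_piece_nb (@pT_inj m) (wT_pT m) (@pT_adj m)) => //.
- exact: wTE.
- by move=> a b; apply: T_adj_nbT.
- by move=> a b; exact: nbT_le.
- by move=> a; exact: nbT_last.
Qed.

Lemma PT_lapop x m i : (i < k m + l m)%N ->
  lapop lam e x (PT m i) = loceq lam (nbT (k m)) (fun a => x (PT m a)) i.
Proof.
move=> ic.
apply: (extend_piece_lapop (@pT_inj m) (wT_pT m) (@pT_adj m)) => //.
- exact: wTE.
- by move=> a b; apply: T_adj_nbT.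
- by move=> a b; exact: nbT_le.
- by move=> a; exact: nbT_last.
- by move=> a; exact: uniq_nbT.
Qed.

Lemma PT_flux m (y : {ffun T -> R^o}) (s : nat -> R) : (forall a, (a < k m + l m)%N -> y (PT m a) = 0) ->
  \sum_(i < k m + l m) lapop lam e y (@pT m i) * s i = - (y (wT m) * s (k m + l m).-1).
Proof.
apply: (extend_piece_flux (@pT_inj m) (wT_pT m) (@pT_adj m)) => //.
- exact: wTE.
- by move=> a b; apply: T_adj_nbT.
- by move=> a b; exact: nbT_le.
- by move=> a; exact: nbT_last.
- by move=> a; exact: uniq_nbT.
- by have := k1 m; lia.
Qed.

Lemma uG j : u j \in Gamma e. Proof. by have [] := dec_P_ends dec j. Qed.
Lemma wG j : w j \in Gamma e. Proof. by have [] := dec_P_ends dec j. Qed.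
Lemma uw j : u j != w j. Proof. by have [] := dec_P_ends dec j. Qed.

Lemma PP0 j : PP j 0 = u j. Proof. by []. Qed.

Lemma PP_ord j (i : 'I_(t j)) : PP j i.+1 = pP i.
Proof. by rewrite /PP /= (nth_map i) ?size_enum_ord // nth_ord_enum. Qed.

Lemma PP_lt j a (at_ : (a < t j)%N) : PP j a.+1 = pP (Ordinal at_).
Proof. exact: (PP_ord (Ordinal at_)). Qed.

Lemma PP_last j : PP j (t j).+1 = w j.
Proof. by rewrite /PP nth_default //= size_codom card_ord. Qed.

Lemma PP_nth j i : PP j i = nth (w j) (u j :: rcons (codom (@pP j)) (w j)) i.
Proof.
by rewrite -rcons_cons nth_rcons /PP if_same; case: ltnP => // si; rewrite nth_default.
Qed.

Lemma PP_uniq j : uniq (u j :: rcons (codom (@pP j)) (w j)).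
Proof.
rewrite cons_uniq rcons_uniq mem_rcons inE negb_or uw /=.
rewrite (map_inj_uniq (@pP_inj j)) enum_uniq andbT.
apply/andP; split; [move: (uG j)|move: (wG j)]; apply: contraL => /codomP[x ->]; exact: f_notin.
Qed.

Lemma PP_edge j i : (i <= t j)%N -> e (PP j i) (PP j i.+1).
Proof.
move=> it; have /(pathP (w j))/(_ i) := dec_P_walk dec j.
rewrite size_rcons size_codom card_ord ltnS => /(_ it).
by rewrite -PP_nth (PP_nth j i.+1).
Qed.

Lemma PP_nbuniq j i : (i < t j)%N -> uniq (map (PP j) (nbP i.+1)).
Proof.
move=> it; rewrite /= inE andbT !PP_nth nth_uniq ?PP_uniq //=; first by lia.
  all: by rewrite size_rcons size_codom card_ord; lia.
Qed.

(** The two positions next to it along the walk are distinct neighbours, and degree 2 leaves room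
    for no other. *)
Lemma PP_nb j i y : (i < t j)%N -> e (PP j i.+1) y = (y \in map (PP j) (nbP i.+1)).
Proof.
move=> it; have un := PP_nbuniq it.
have : [set z in map (PP j) (nbP i.+1)] == [set z | e (PP j i.+1) z].
  rewrite eqEcard; apply/andP; split.
    apply/subsetP=> z; rewrite !inE => /orP[/eqP->|/eqP->].
      by rewrite e_sym PP_edge // ltnW.
    by rewrite PP_edge.
  have -> : #|[set z in map (PP j) (nbP i.+1)]| = 2%N by rewrite cardsE (card_uniqP un).
  rewrite PP_lt.
  by have := dec_P_degree dec (Ordinal it); rewrite /degree => ->.
by move/eqP/setP/(_ y); rewrite inE [RHS]inE => <-.
Qed.

Lemma PP_lapop x j i : (i < t j)%N ->
  lapop lam e x (PP j i.+1) = loceq lam nbP (fun a => x (PP j a)) i.+1.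
Proof.
move=> it; apply: lapop_loceq; first exact: PP_nbuniq.
by move=> y; exact: PP_nb.
Qed.

Lemma PP_flux j (y : {ffun T -> R^o}) (s : nat -> R) : (0 < t j)%N ->
  (forall a, (a < t j)%N -> y (PP j a.+1) = 0) ->
  \sum_(i < t j) lapop lam e y (@pP j i) * s i =
    - (y (u j) * s 0%N + y (w j) * s (t j).-1).
Proof.
move=> t0 y0.
(* For [t j = 1] the same vertex receives both end terms. *)
have lapE (i : 'I_(t j)) : lapop lam e y (@pP j i) =
    - (y (u j) *+ (i == 0%N :> nat) + y (w j) *+ (i == (t j).-1 :> nat)).
  have it := ltn_ord i.
  rewrite -PP_ord PP_lapop // /loceq y0 // mulr0 sub0r !big_cons big_nil addr0 /=.
  congr (- (_ + _)).
    by case: (nat_of_ord i) it => [|i'] // it; rewrite y0 //; lia.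
  case: eqP => [->|it']; first by rewrite prednK // PP_last.
  by rewrite y0 //; lia.
under eq_bigr do rewrite lapE mulNr mulrDl.
rewrite sumrN big_split /=; congr (- (_ + _)).
  rewrite (bigD1 (Ordinal t0)) //= mulr1n big1 ?addr0 // => i i0.
  rewrite (_ : (i == 0%N :> nat) = false) ?mul0r //.
  by apply: contraNF i0 => /eqP i0; apply/eqP/val_inj.
have t1 : ((t j).-1 < t j)%N by rewrite prednK.
rewrite (bigD1 (Ordinal t1)) //= eqxx mulr1n big1 ?addr0 // => i i0.
rewrite (_ : (i == (t j).-1 :> nat) = false) ?mul0r //.
by apply: contraNF i0 => /eqP i0; apply/eqP/val_inj.
Qed.

Lemma piece_cases v : v \notin Gamma e ->
  [\/ exists m i, (i < nC m)%N /\ v = PC m i,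
      exists m i, (i < k m + l m)%N /\ v = PT m i
    | exists j i, (i < t j)%N /\ v = PP j i.+1].
Proof.
case/notin_f=> [[[[m i]|[m i]]|[j i]] ->].
- by constructor 1; exists m, i; split; rewrite ?ltn_ord // /PC extend_piece_ord.
- by constructor 2; exists m, i; split; rewrite ?ltn_ord // /PT extend_piece_ord.
- by constructor 3; exists j, i; split; rewrite ?ltn_ord // PP_ord.
Qed.

(** * Connectedness of the skeleton on Gamma *)

Definition home_index (z : CG g h + TG k l + PG t) : T :=
  match z with
  | inl (inl s) => wC (tag s)
  | inl (inr s) => wT (tag s)
  | inr s => u (tag s)
  end.

(* Sends each piece to a vertex of Gamma it is attached to, which turns walks *)
(* of G into walks of the skeleton.                                           *)
Definition home v := if [pick z | f z == v] is Some z then home_index z else v.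

Lemma home_f z : home (f z) = home_index z.
Proof.
rewrite /home; case: pickP => [z' /eqP/(Defs.dec_inj dec) -> //|/(_ z)].
by rewrite eqxx.
Qed.

Lemma home_G v : v \in Gamma e -> home v = v.
Proof.
move=> vG; rewrite /home; case: pickP => // z /eqP fz.
by have := f_notin z; rewrite fz vG.
Qed.

Lemma home_PC m a : home (PC m a) = wC m.
Proof.
rewrite /PC; have [an|an] := ltnP a (nC m).
  by rewrite (extend_piece_lt _ _ an) home_f.
by rewrite extend_piece_ge // home_G.
Qed.

Lemma home_PT m a : home (PT m a) = wT m.
Proof.
rewrite /PT; have [an|an] := ltnP a (k m + l m).
  by rewrite (extend_piece_lt _ _ an) home_f.
by rewrite extend_piece_ge // home_G.
Qed.

Lemma home_PP j a : home (PP j a) = u j \/ home (PP j a) = w j.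
Proof.
case: a => [|a]; first by left; rewrite PP0 home_G ?uG.
have [at_|at_] := ltnP a (t j); first by left; rewrite (PP_lt at_) home_f.
by right; rewrite /PP nth_default ?home_G ?wG //= size_codom card_ord.
Qed.

(** If no internal path left [W], membership of [home v] in [W] would be constant along every edge
    of G, hence on the connected graph G. *)
Lemma skeleton_crossing (W : {set T}) : W \subset Gamma e -> W != set0 -> W != Gamma e ->
  exists j, (u j \in W) != (w j \in W).
Proof.
move=> WG W0 WnG; apply/existsP; apply: contraT; rewrite negb_exists => /forallP nj.
have {}nj j : (u j \in W) = (w j \in W) by have := nj j; rewrite negbK => /eqP.
have PPW j a : (home (PP j a) \in W) = (u j \in W) by case: (home_PP j a) => ->.
have clo1 v v' : v \notin Gamma e -> e v v' -> (home v \in W) = (home v' \in W).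
  move=> vG; case: (piece_cases vG) => [] [m] [i] [im ->].
  - by rewrite PC_nb // => /mapP[a _ ->]; rewrite !home_PC.
  - by rewrite PT_nb // => /mapP[a _ ->]; rewrite !home_PT.
  - by rewrite PP_nb // => /mapP[a _ ->]; rewrite !PPW.
have clo v v' : e v v' -> (home v \in W) = (home v' \in W).
  have [vG|vG] := boolP (v \in Gamma e); last exact: clo1.
  have [v'G|v'G] := boolP (v' \in Gamma e); last by rewrite e_sym => /clo1 -> //.
  move=> vv'; have [j [[_ /setP sj] _]] := dec_P_edge dec vG v'G vv'.
  rewrite !home_G //.
  have vW x : x \in [set u j; w j] -> (x \in W) = (u j \in W).
    by rewrite !inE => /orP[] /eqP-> //.
  by rewrite !vW // sj !inE eqxx ?orbT.
have con v v' : (home v \in W) = (home v' \in W).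
  have cl : closed e [pred v | home v \in W] by move=> x y xy; rewrite !inE (clo x y).
  by have := closed_connect cl (e_conn v v'); rewrite !inE.
have /set0Pn[v vW] := W0.
have /properP[_ [v' v'G v'W]] : W \proper Gamma e by rewrite properEneq WnG.
have := con v v'; rewrite !home_G ?vW ?(negbTE v'W) //.
exact: (subsetP WG).
Qed.

(** * Counting attachments at the vertices of Gamma *)

Definition attach (z : 'I_c + 'I_q + ('I_np + 'I_np)) : T :=
  match z with
  | inl (inl m) => wC m
  | inl (inr i) => wT i
  | inr (inl j) => u j
  | inr (inr j) => w j
  end.

(* For t j = 0 the two halves of the j-th edge give PP j 1 = w j, PP j 0 = u j. *)
Definition attached (z : 'I_c + 'I_q + ('I_np + 'I_np)) : T :=
  match z with
  | inl (inl m) => PC m (nC m).-1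
  | inl (inr i) => PT i (k i + l i).-1
  | inr (inl j) => PP j 1
  | inr (inr j) => PP j (t j)
  end.

(** An edge inside Gamma is an internal path with [t j = 0]; an edge into a piece reaches it at its
    last vertex or at an end of an internal path. *)
Lemma Gamma_neighbour v y : v \in Gamma e -> e v y ->
  exists2 z, attach z = v & attached z = y.
Proof.
move=> vG vy; have [yG|yG] := boolP (y \in Gamma e).
  have [j [[tj sj] _]] := dec_P_edge dec vG yG vy.
  have vj : v \in [set u j; w j] by rewrite sj !inE eqxx.
  have yj : y \in [set u j; w j] by rewrite sj !inE eqxx orbT.
  have uj : u j \in [set v; y] by rewrite -sj !inE eqxx.
  have wj : w j \in [set v; y] by rewrite -sj !inE eqxx orbT.
  have wE : PP j 1 = w j by rewrite -(PP_last j) tj.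
  have := uw j; move: vj; rewrite !inE => /orP[/eqP vu|/eqP vw] ujw.
    exists (inr (inl j)) => //=; rewrite wE; move: wj; rewrite !inE => /orP[/eqP wv|/eqP //].
    by rewrite -vu wv eqxx in ujw.
  exists (inr (inr j)) => //=; rewrite tj PP0; move: uj; rewrite !inE => /orP[/eqP wv|/eqP //].
  by rewrite -vw wv eqxx in ujw.
move: vy; rewrite e_sym; have nvf z : f z != v.
  by apply: contraTneq vG => <-; exact: f_notin.
case: (piece_cases yG) => [] [m] [i] [im ->].
- rewrite PC_nb // => /mapP[a ai va]; have := nbC_le im ai.
  have [an|an] := ltnP a (nC m).
    by have := nvf (inl (inl (Tagged (fun m => 'I_(g m + h m - 1)) (Ordinal an))));
       rewrite va /PC (extend_piece_lt _ _ an) eqxx.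
  move=> an'; have {an an'} aE : a = nC m by lia.
  exists (inl (inl m)); first by rewrite va aE /PC extend_piece_last.
  by rewrite aE nbC_last // in ai; rewrite /= -(eqP ai).
- rewrite PT_nb // => /mapP[a ai va]; have := nbT_le im ai.
  have [an|an] := ltnP a (k m + l m).
    by have := nvf (inl (inr (Tagged (fun m => 'I_(k m + l m)) (Ordinal an))));
       rewrite va /PT (extend_piece_lt _ _ an) eqxx.
  move=> an'; have {an an'} aE : a = (k m + l m)%N by lia.
  exists (inl (inr m)); first by rewrite va aE /PT extend_piece_last.
  by rewrite aE nbT_last // in ai; rewrite /= -(eqP ai).
- rewrite PP_nb // => /mapP[a]; rewrite !inE /= => ai va.
  have aE : a = 0%N \/ a = (t m).+1.
    case: a ai va => [|a] ai va; first by left.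
    right; have [at_|at_] := ltnP a (t m); last by lia.
    by have := nvf (inr (Tagged (fun m => 'I_(t m)) (Ordinal at_)));
       rewrite va (PP_lt at_) eqxx.
  case: aE va => aE ->; rewrite aE in ai *.
    by exists (inr (inl m)) => //=; congr PP; lia.
  by exists (inr (inr m)); rewrite ?PP_last //=; congr PP; lia.
Qed.

Lemma Gamma_degree v : v \in Gamma e -> (degree e v <= #|[set z | attach z == v]|)%N.
Proof.
move=> vG; apply: leq_trans (leq_imset_card attached _).
apply/subset_leq_card/subsetP=> y; rewrite inE => /(Gamma_neighbour vG)[z zv <-].
by apply: imset_f; rewrite inE zv.
Qed.

(** Vertices of Gamma have degree at least 3, and each incident edge uses its own attachment. *)
Lemma card_attach_ge (W : {set T}) : W \subset Gamma e ->
  (3 * #|W| <= #|[set m | wC m \in W]| + #|[set i | wT i \in W]| +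
     (#|[set j | u j \in W]| + #|[set j | w j \in W]|))%N.
Proof.
move=> WG.
apply: (@leq_trans (\sum_(v in W) #|[set z | attach z == v]|)).
  rewrite mulnC -sum_nat_const; apply: leq_sum => v /(subsetP WG) vG.
  by apply: leq_trans (Gamma_degree vG); move: vG; rewrite inE => /and3P[].
under eq_bigr do rewrite card_set_sum.
rewrite exchange_big /= (card_set_sum (fun m => wC m \in W)) (card_set_sum (fun m => wT m \in W)).
rewrite (card_set_sum (fun m => u m \in W)) (card_set_sum (fun m => w m \in W)).
have att x : (\sum_(v in W) (x == v) = (x \in W))%N.
  case: (boolP (x \in W)) => xW; last first.
    by rewrite big1 // => v vW; case: eqP => // xv; rewrite -xv (negbTE xW) in vW.
  by rewrite (bigD1 x) //= eqxx big1 // => v /andP[_ /negbTE]; rewrite eq_sym => ->.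
under eq_bigr do rewrite att.
by rewrite !big_sumType.
Qed.

(** * Coordinates on the solutions vanishing on Gamma *)

Local Notation index := ('I_c * bool + 'I_q + 'I_np)%type.

Definition goodC m := lasso_good lam (g m) (h m).
Definition goodT i := starchain lam (k i) (l i) == 0.
Definition goodP j := chain lam 0 1 (t j).+1 == 0.

Definition good_index (z : index) : bool :=
  match z with
  | inl (inl (m, _)) => goodC m
  | inl (inr i) => goodT i
  | inr j => goodP j
  end.

(* A bad C(g, h) keeps the one of its two coordinates singled out by          *)
(* [lasso_bad].                                                               *)
Definition free_index (z : index) : bool :=
  match z with
  | inl (inl (m, b)) => goodC m || (b != (chain lam 0 1 (g m) == 0))
  | inl (inr i) => goodT i
  | inr j => goodP j
  end.

(** The vertex where a coordinate is read off. For [t j = 0] the probe [PP j 1] is [w j], in Gamma,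
    but then [goodP j] fails and the index is not free. *)
Definition probe (z : index) : T :=
  match z with
  | inl (inl (m, b)) => PC m (if b then (g m).-1 else 0)
  | inl (inr i) => PT i (k i)
  | inr j => PP j 1
  end.

Lemma PC_notG m i : (i < nC m)%N -> PC m i \notin Gamma e.
Proof. by move=> im; rewrite /PC (extend_piece_lt _ _ im) f_notin. Qed.

Lemma PT_notG m i : (i < k m + l m)%N -> PT m i \notin Gamma e.
Proof. by move=> im; rewrite /PT (extend_piece_lt _ _ im) f_notin. Qed.

Lemma PP_notG j i : (i < t j)%N -> PP j i.+1 \notin Gamma e.
Proof. by move=> im; rewrite (PP_lt im) f_notin. Qed.

(** On each piece the probe values determine the solution, and vanishing at the attachment vertices
    kills the coordinates that are not free. *)
Lemma dim_K_le : (\dim (dirker lam e (Gamma e)) <= #|[set z | free_index z]|)%N.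
Proof.
apply: (@dim_le_evals _ _ _ _ probe) => x /dirkerP[x0 xe] xz.
have {}xz z : free_index z -> x (probe z) = 0 by move=> fz; apply: xz; rewrite inE.
apply/ffunP=> v; rewrite ffunE; have [/x0//|vG] := boolP (v \in Gamma e).
case: (piece_cases vG) => [] [m] [i] [im ->].
- have Xe a : (a < nC m)%N -> loceq lam (nbC (g m)) (fun a => x (PC m a)) a = 0.
    by move=> am; rewrite -PC_lapop // xe // PC_notG.
  have Xn : x (PC m (nC m)) = 0 by rewrite /PC extend_piece_last x0.
  have gn : (3 <= g m <= nC m)%N by have := g3 m; have := h1 m; rewrite /nC; lia.
  have [X0 X1] : x (PC m 0) = 0 /\ x (PC m (g m).-1) = 0.
    have xt := xz (inl (inl (m, true))); have xf := xz (inl (inl (m, false))).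
    rewrite /= in xt xf.
    have [gm|bm] := boolP (goodC m); first by rewrite xt ?xf ?gm.
    have := lasso_bad (g3 m) (h1 m) bm Xe Xn; move: xt xf; rewrite (negbTE bm) /=.
    case: ifP => _ /= xt xf hb; first by have X0 := xf isT; split=> //; exact: hb.
    by have X1 := xt isT; split=> //; exact: hb.
  by apply: (lasso_zero gn Xe X0 X1); exact: ltnW.
- have Xe a : (a < k m + l m)%N -> loceq lam (nbT (k m)) (fun a => x (PT m a)) a = 0.
    by move=> am; rewrite -PT_lapop // xe // PT_notG.
  have Xn : x (PT m (k m + l m)) = 0 by rewrite /PT extend_piece_last x0.
  have uni := star_uniq lam1 (l1 m) Xe; rewrite /= in uni.
  suff Xk : x (PT m (k m)) = 0 by rewrite uni ?(ltnW im) // Xk /solT !mul0r if_same.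
  have [gm|bm] := boolP (goodT m); first exact: (xz (inl (inr m))).
  have /eqP := uni _ (leqnn _); rewrite Xn /solT ifF ?addKn; last by lia.
  by rewrite eq_sym mulf_eq0 [_ == 0 in X in _ || X](negbTE bm) orbF => /eqP.
- have Xe a : (a < t m)%N -> loceq lam nbP (fun a => x (PP m a)) a.+1 = 0.
    by move=> am; rewrite -PP_lapop // xe // PP_notG.
  have Xn : x (PP m (t m).+1) = 0 by rewrite PP_last x0 ?wG.
  have uni := path_uniq Xe; rewrite /= PP0 (x0 _ (uG m)) in uni.
  have {}uni a : (a <= (t m).+1)%N -> x (PP m a) = x (PP m 1) * chain lam 0 1 a.
    by move=> am; rewrite uni // -chain_scale mulr0 mulr1.
  suff Xk : x (PP m 1) = 0 by rewrite uni ?Xk ?mul0r // ltnW.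
  have [gm|bm] := boolP (goodP m); first exact: (xz (inr m)).
  have /eqP := uni _ (leqnn _); rewrite Xn.
  by rewrite eq_sym mulf_eq0 [_ == 0 in X in _ || X](negbTE bm) orbF => /eqP.
Qed.

(** A bad C(g, h) loses one of its two coordinates; a bad T(k, l) or internal path loses its only
    one. *)
Lemma card_free_index :
  (#|[set z | free_index z]| + #|[set m | ~~ goodC m]| + #|[set i | ~~ goodT i]|
     + #|[set j | ~~ goodP j]| = 2 * c + q + np)%N.
Proof.
rewrite (card_set_sum free_index) !big_sumType /=.
have -> : (\sum_(i : 'I_c * bool) free_index (inl (inl i)) =
    \sum_m \sum_(b : bool) free_index (inl (inl (m, b))))%N.
  by rewrite pair_bigA; apply: eq_bigr => -[].
rewrite (card_set_sum (fun m => ~~ goodC m)) (card_set_sum (fun m => ~~ goodT m)).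
rewrite (card_set_sum (fun m => ~~ goodP m)).
have eC : (\sum_m \sum_(b : bool) free_index (inl (inl (m, b))) +
    \sum_m ~~ goodC m = 2 * c)%N.
  rewrite -big_split /= (eq_bigr (fun=> 2)) => [|m _].
    by rewrite sum_nat_const card_ord mulnC.
  by rewrite big_bool; case: (goodC m) => //=; case: (_ == 0).
have eT : (\sum_i free_index (inl (inr i)) + \sum_i ~~ goodT i = q)%N.
  rewrite -big_split /= (eq_bigr (fun=> 1)) => [|m _].
    by rewrite sum_nat_const card_ord muln1.
  by case: (goodT m).
have eP : (\sum_i free_index (inr i) + \sum_i ~~ goodP i = np)%N.
  rewrite -big_split /= (eq_bigr (fun=> 1)) => [|m _].
    by rewrite sum_nat_const card_ord muln1.
  by case: (goodP m).
have arith a b d a1 b1 d1 X Y Z : (a + a1 = X -> b + b1 = Y -> d + d1 = Z ->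
  a + b + d + a1 + b1 + d1 = X + Y + Z)%N by lia.
exact: arith eC eT eP.
Qed.

(** * Gluing solutions on the good pieces *)

Definition piece_sol (b : index -> R) (z : CG g h + TG k l + PG t) : R :=
  match z with
  | inl (inl s) => solC lam (g (tag s)) (b (inl (inl (tag s, false))))
                     (b (inl (inl (tag s, true)))) (tagged s)
  | inl (inr s) => solT lam (k (tag s)) (b (inl (inr (tag s)))) (tagged s)
  | inr s => b (inr (tag s)) * chain lam 0 1 (tagged s).+1
  end.

Definition glue (b : index -> R) : {ffun T -> R^o} :=
  [ffun v => if [pick z | f z == v] is Some z then piece_sol b z else 0].

Lemma glue_f b z : glue b (f z) = piece_sol b z.
Proof.
rewrite ffunE; case: pickP => [z' /eqP/(Defs.dec_inj dec) -> //|/(_ z)].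
by rewrite eqxx.
Qed.

Lemma glue_G b v : v \in Gamma e -> glue b v = 0.
Proof.
move=> vG; rewrite ffunE; case: pickP => // z /eqP fz.
by have := f_notin z; rewrite fz vG.
Qed.

Lemma solC0 n a : solC lam n 0 0 a = 0.
Proof. by rewrite /solC !chain_00 if_same. Qed.

Lemma solT0 n a : solT lam n 0 a = 0.
Proof. by rewrite /solT !mul0r if_same. Qed.

Section Glue.
Variable b : index -> R.
Hypothesis b_good : forall z, ~~ good_index z -> b z = 0.

(** The formula persists at the attachment vertex: there a good piece gives 0, the value of [glue]
    on Gamma, while a bad piece carries the zero solution. Hence the local equations hold up to the
    last vertex. *)
Lemma glue_PC m a : (a <= nC m)%N ->
  glue b (PC m a) = solC lam (g m) (b (inl (inl (m, false)))) (b (inl (inl (m, true)))) a.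
Proof.
rewrite leq_eqVlt => /orP[/eqP->|am]; last by rewrite /PC (extend_piece_lt _ _ am) glue_f.
rewrite /PC extend_piece_last glue_G //.
have [gm|bm] := boolP (goodC m); last by rewrite !b_good // solC0.
have := g3 m; have := h1 m => hm gm'.
rewrite /solC ifF /nC; last by lia.
have -> : ((g m + h m - 1).+1 - g m = h m)%N by lia.
rewrite -{1 2}[b _]mulr1 chain_scale; case/andP: gm => _ /eqP ->.
by rewrite mulr0.
Qed.

Lemma glue_PT m a : (a <= k m + l m)%N ->
  glue b (PT m a) = solT lam (k m) (b (inl (inr m))) a.
Proof.
rewrite leq_eqVlt => /orP[/eqP->|am]; last by rewrite /PT (extend_piece_lt _ _ am) glue_f.
rewrite /PT extend_piece_last glue_G //.
have [gm|bm] := boolP (goodT m); last by rewrite !b_good // solT0.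
by rewrite /solT ifF ?addKn ?(eqP gm) ?mulr0 //; lia.
Qed.

Lemma glue_PP j a : (a <= (t j).+1)%N -> glue b (PP j a) = b (inr j) * chain lam 0 1 a.
Proof.
case: a => [|a]; first by rewrite PP0 glue_G ?uG ?mulr0.
rewrite ltnS leq_eqVlt => /orP[/eqP->|am]; last by rewrite (PP_lt am) glue_f.
rewrite PP_last glue_G ?wG //.
have [gm|bm] := boolP (goodP j); last by rewrite !b_good // mul0r.
by rewrite (eqP gm) mulr0.
Qed.

Lemma loceq0 nb X i : (forall a, X a = 0) -> loceq lam nb X i = 0.
Proof. by move=> X0; rewrite /loceq X0 mulr0 big1 ?subr0. Qed.

Lemma glue_K : glue b \in dirker lam e (Gamma e).
Proof.
apply/dirkerP; split=> v vG; first exact: glue_G.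
case: (piece_cases vG) => [] [m] [i] [im ->].
- rewrite PC_lapop // (@eq_loceq _ _ _ _ _ _ (glue_PC (ltnW im))); last first.
    by move=> a /(nbC_le im)/glue_PC.
  have [gm|bm] := boolP (goodC m); first by apply: lasso_sol => //; case/andP: gm.
  by apply: loceq0 => a; rewrite !b_good ?solC0.
- rewrite PT_lapop // (@eq_loceq _ _ _ _ _ _ (glue_PT (ltnW im))); last first.
    by move=> a /(nbT_le im)/glue_PT.
  exact: star_sol.
- rewrite PP_lapop // (@eq_loceq _ _ _ _ (fun a => b (inr m) * chain lam 0 1 a)); first last.
  + by move=> a; rewrite !inE => ai; rewrite glue_PP //; lia.
  + by rewrite glue_PP // ltnW.
  have := path_sol lam 0 (b (inr m)) i; congr (_ = _); apply: eq_loceq.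
    by rewrite -chain_scale mulr0 mulr1.
  by move=> a _; rewrite -chain_scale mulr0 mulr1.
Qed.

Lemma glue_probe z : glue b (probe z) = b z.
Proof.
case: z => [[[m d]|m]|j] /=.
- have := g3 m; have := h1 m => hm gm.
  rewrite glue_PC; last by case: d; rewrite /nC; lia.
  have [good|bad] := boolP (goodC m); last by rewrite !b_good ?solC0 //; case: d.
  have [cg _] := cyc_good_chain (b (inl (inl (m, true)))) (b (inl (inl (m, false)))) (andP good).1.
  case: d; rewrite /solC ifT //; try lia.
  by rewrite prednK ?cg //; lia.
- by rewrite glue_PT ?leq_addr // /solT ltnn subnn mulr1.
- by rewrite glue_PP //= mulr1.
Qed.

End Glue.

Lemma dim_K_ge : (forall z, good_index z) -> (2 * c + q + np <= \dim (dirker lam e (Gamma e)))%N.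
Proof.
move=> good; have := @dim_ge_evals R T _ [set: index] probe (dirker lam e (Gamma e)).
rewrite cardsT !card_sum card_prod card_bool !card_ord mulnC; apply=> b _.
have b_good z : ~~ good_index z -> b z = 0 by rewrite good.
by exists (glue b); [exact: glue_K | move=> z _; exact: glue_probe].
Qed.

(** * Functions on Gamma orthogonal to all fluxes *)

Section Dual.
Variable y : {ffun T -> R^o}.
Hypothesis y0 : forall v, v \notin Gamma e -> y v = 0.
Hypothesis y_flux : forall x, x \in dirker lam e (Gamma e) ->
  \sum_v y v * lapop lam e x v = 0.

Let unit_index (z z' : index) : R := (z' == z)%:R.

Lemma unit_index_good z : good_index z ->
  forall z', ~~ good_index z' -> unit_index z z' = 0.
Proof. by move=> gz z'; rewrite /unit_index; case: eqP => // ->; rewrite gz. Qed.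

(** Green's identity moves the operator to [y]. As [y] lives on Gamma and the glued function on one
    piece, only the edges joining that piece to Gamma contribute. *)
Lemma dual_glue z : good_index z -> \sum_v lapop lam e y v * glue (unit_index z) v = 0.
Proof.
move=> gz; rewrite -lapop_sym //; apply: y_flux; apply: glue_K.
exact: unit_index_good.
Qed.

(** The identity reads [y (wC m)] times the last value of the tail, and that value is nonzero
    because the next one vanishes. *)
Lemma dual_goodC m : goodC m -> y (wC m) = 0.
Proof.
move=> gm; have /andP[_ /eqP gh] := gm.
(* The other coordinate vanishes at the junction, hence on the whole tail, and has no flux. *)
have := @dual_glue (inl (inl (m, true))) gm.
rewrite (@sum_piece _ _ _ (@pC m)) //; last first.
- move=> v vp; have [vG|/notin_f[z vz]] := boolP (v \in Gamma e).
    by rewrite glue_G // mulr0.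
  rewrite vz glue_f; case: z => [[[m' i]|s]|s] /= in vz *.
  + have [mm|mm] := eqVneq m' m.
      by move: i vz; rewrite mm => i vz; move: vp; rewrite vz codom_f.
    have b0 d : unit_index (inl (inl (m, true))) (inl (inl (m', d))) = 0.
      by rewrite /unit_index; case: eqP => // -[] /eqP; rewrite (negbTE mm).
    by rewrite !b0 solC0 mulr0.
  + by rewrite solT0 mulr0.
  + by rewrite mul0r mulr0.
- exact: pC_inj.
under eq_bigr => i _ do rewrite glue_f /=.
rewrite (PC_flux (solC lam (g m) (unit_index (inl (inl (m, true))) (inl (inl (m, false))))
  (unit_index (inl (inl (m, true))) (inl (inl (m, true)))))); last first.
  by move=> a am; rewrite y0 // PC_notG.
have -> : unit_index (inl (inl (m, true))) (inl (inl (m, true))) = 1 by rewrite /unit_index eqxx.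
move/eqP; rewrite oppr_eq0 mulf_eq0 => /orP[/eqP //|].
(* The last vertex of the piece lies beyond the cycle, so the tail branch of [solC] applies. *)
have := lasso_good_gt2 lam1 gm; have := g3 m => gm3 hm2.
rewrite /solC ifF /nC; last by lia.
have -> : ((g m + h m - 1).-1.+1 - g m = (h m).-1)%N by lia.
move/eqP=> e1; have [] := @chain_eq0 _ lam 1 1 (h m).-1 e1.
  by rewrite prednK //; lia.
by move/eqP; rewrite oner_eq0.
Qed.

Lemma dual_goodT m : goodT m -> y (wT m) = 0.
Proof.
move=> gm; have /eqP gl := gm.
have := @dual_glue (inl (inr m)) gm.
rewrite (@sum_piece _ _ _ (@pT m)) //; last first.
- move=> v vp; have [vG|/notin_f[z vz]] := boolP (v \in Gamma e).
    by rewrite glue_G // mulr0.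
  rewrite vz glue_f; case: z => [[s|[m' i]]|s] /= in vz *.
  + by rewrite solC0 mulr0.
  + have [mm|mm] := eqVneq m' m.
      by move: i vz; rewrite mm => i vz; move: vp; rewrite vz codom_f.
    have -> : unit_index (inl (inr m)) (inl (inr m')) = 0.
      by rewrite /unit_index; case: eqP => // -[] /eqP; rewrite (negbTE mm).
    by rewrite solT0 mulr0.
  + by rewrite mul0r mulr0.
- exact: pT_inj.
under eq_bigr => i _ do rewrite glue_f /=.
rewrite (PT_flux (solT lam (k m) (unit_index (inl (inr m)) (inl (inr m))))); last first.
  by move=> a am; rewrite y0 // PT_notG.
have -> : unit_index (inl (inr m)) (inl (inr m)) = 1 by rewrite /unit_index eqxx.
move/eqP; rewrite oppr_eq0 mulf_eq0 => /orP[/eqP //|].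
have := l1 m; have := k1 m => km lm.
rewrite /solT ifF; last by lia.
have -> : ((k m + l m).-1 - k m = (l m).-1)%N by lia.
rewrite mul1r => /eqP e1; have [] := chain_eq0 e1.
  by rewrite prednK.
by move/eqP; rewrite oner_eq0.
Qed.

Lemma goodP_gt0 j : goodP j -> (0 < t j)%N.
Proof. by rewrite /goodP; case: (t j) => //=; rewrite oner_eq0. Qed.

(** The solution on the path is [chain 0 1], with value 1 next to [u j] and [chain 0 1 (t j)] next
    to [w j]. *)
Lemma dual_goodP j : goodP j -> y (u j) + chain lam 0 1 (t j) * y (w j) = 0.
Proof.
move=> gj; have tj := goodP_gt0 gj.
have := @dual_glue (inr j) gj.
rewrite (@sum_piece _ _ _ (@pP j)) //; last first.
- move=> v vp; have [vG|/notin_f[z vz]] := boolP (v \in Gamma e).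
    by rewrite glue_G // mulr0.
  rewrite vz glue_f; case: z => [[s|s]|[m' i]] /= in vz *.
  + by rewrite solC0 mulr0.
  + by rewrite solT0 mulr0.
  + have [mm|mm] := eqVneq m' j.
      by move: i vz; rewrite mm => i vz; move: vp; rewrite vz codom_f.
    have -> : unit_index (inr j) (inr m') = 0.
      by rewrite /unit_index; case: eqP => // -[] /eqP; rewrite (negbTE mm).
    by rewrite mul0r mulr0.
- exact: pP_inj.
under eq_bigr => i _ do rewrite glue_f /=.
have -> : unit_index (inr j) (inr j) = 1 by rewrite /unit_index eqxx.
rewrite (PP_flux (fun i => 1 * chain lam 0 1 i.+1) tj); last first.
  by move=> a am; rewrite y0 // PP_notG.
cbv beta; rewrite prednK // !mul1r => /eqP; rewrite oppr_eq0 => /eqP y_uw.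
by rewrite -[RHS]y_uw (_ : chain lam 0 1 1 = 1) // mulr1 [X in _ + X]mulrC.
Qed.

End Dual.

Lemma chain_end_neq0 j : goodP j -> chain lam 0 1 (t j) != 0.
Proof.
move=> /eqP gj; apply/negP => /eqP e1; have [_] := chain_eq0 e1 gj.
by move/eqP; rewrite oner_eq0.
Qed.

(** * Comparing the dimensions *)

Hypothesis c_gt0 : (0 < c)%N.

(** Some C(g, h) is attached to Gamma, so Gamma is nonempty and the subtraction in [np] is exact. *)
Lemma card_Gamma : (np + 1 = #|Gamma e|)%N.
Proof.
by rewrite subnK // card_gt0; apply/set0Pn; exists (wC (Ordinal c_gt0)).
Qed.

Lemma dim_eigenspace_good :
  \dim (dirker lam e set0) = (2 * c + q - 1)%N <-> forall z, good_index z.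
Proof.
have [Y [Y0 YK dE]] := dirker0_dual lam (Gamma e) e_sym.
pose U := [set v | `[< exists2 y, y \in Y & y v != 0 >]].
have UG : U \subset Gamma e.
  apply/subsetP=> v; rewrite inE => /asboolP[y yY]; apply: contraR => vG.
  by rewrite (Y0 _ _ yY vG).
have YU y v : y \in Y -> v \notin U -> y v = 0.
  move=> yY; rewrite inE => /asboolPn nv; apply/eqP/negPn/negP => yv.
  by apply: nv; exists y.
have Y_dual y : y \in Y -> (forall v, v \notin Gamma e -> y v = 0) /\
    (forall x, x \in dirker lam e (Gamma e) -> \sum_v y v * lapop lam e x v = 0).
  by move=> yY; split=> [v|x xK]; [exact: Y0 | exact: YK].
have badC m : wC m \in U -> ~~ goodC m.
  rewrite inE => /asboolP[y yY]; apply: contraNN => gm; apply/eqP.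
  by have [y0 yf] := Y_dual _ yY; exact: (dual_goodC y0 yf gm).
have badT m : wT m \in U -> ~~ goodT m.
  rewrite inE => /asboolP[y yY]; apply: contraNN => gm; apply/eqP.
  by have [y0 yf] := Y_dual _ yY; exact: (dual_goodT y0 yf gm).
have YP y j : y \in Y -> goodP j -> y (u j) + chain lam 0 1 (t j) * y (w j) = 0.
  by move=> /Y_dual[y0 yf]; exact: dual_goodP.
have UP j : goodP j -> (u j \in U) = (w j \in U).
  move=> gj; rewrite !inE; apply/asboolP/asboolP => -[y yY yj]; exists y => //.
    apply: contraNneq yj => y0; have := YP _ _ yY gj; rewrite y0 mulr0 addr0.
    by move/eqP.
  apply: contraNneq yj => y0; have := YP _ _ yY gj; rewrite y0 add0r.
  by move/eqP; rewrite mulf_eq0 (negbTE (chain_end_neq0 gj)).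
pose Q := [set j in inner u w U | goodP j].
have cardJ : (#|'I_np| + 1 = #|Gamma e|)%N by rewrite card_ord card_Gamma.
have dY : (\dim Y + #|Q| <= #|U|)%N.
  apply: (edge_functionals_dim skeleton_crossing uG wG cardJ uw (b := fun j => chain lam 0 1 (t j)) UG) => //.
  - by apply/subsetP=> j; rewrite inE => /andP[].
  - by move=> j; rewrite inE => /andP[_ /chain_end_neq0].
  - by move=> y j yY; rewrite inE => /andP[_]; exact: YP.
(* A good path has both ends in [U] or none, and counts in [inner] and in [Q]; a bad path with one
   end in [U] is covered by its badness, with two ends also by [inner]. *)
have ends : (#|[set j | u j \in U]| + #|[set j | w j \in U]| <=
    #|inner u w U| + #|[set j | ~~ goodP j]| + #|Q|)%N.
  rewrite (card_set_sum (fun j => u j \in U)) (card_set_sum (fun j => w j \in U)).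
  rewrite (card_set_sum (fun j => ~~ goodP j)) (card_set_sum (fun j => (u j \in U) && (w j \in U))).
  rewrite (card_set_sum (fun j => (j \in inner u w U) && goodP j)) -!big_split /=.
  apply: leq_sum => j _; rewrite [j \in inner _ _ _]inE; have := UP j.
  by case: (goodP j) => [/(_ isT) ->|_]; case: (u j \in U); case: (w j \in U).
have subC : (#|[set m | wC m \in U]| <= #|[set m | ~~ goodC m]|)%N.
  by apply/subset_leq_card/subsetP=> m; rewrite !inE => mU; apply: badC; rewrite inE.
have subT : (#|[set m | wT m \in U]| <= #|[set m | ~~ goodT m]|)%N.
  by apply/subset_leq_card/subsetP=> m; rewrite !inE => mU; apply: badT; rewrite inE.
have att := card_attach_ge UG.
have free := card_free_index; have dK := dim_K_le; have cG := card_Gamma.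
have innerU : (0 < #|U| -> #|inner u w U| < #|U|)%N.
  by rewrite card_gt0; exact: (inner_lt skeleton_crossing uG wG cardJ).
have [le1 le2] := deficiency_count dE dK free cG dY ends subC subT att innerU.
split=> [dimE z|good].
  have [//|] := posnP (#|[set m | ~~ goodC m]| + #|[set m | ~~ goodT m]| +
      #|[set j | ~~ goodP j]|)%N; last by move/le2; rewrite dimE; lia.
  move/eqP; rewrite !addn_eq0 !cards_eq0 => /andP[/andP[/eqP/setP C0 /eqP/setP T0] /eqP/setP P0].
  case: z => [[[m b]|m]|m] /=.
  - by have := C0 m; rewrite !inE => /negbFE.
  - by have := T0 m; rewrite !inE => /negbFE.
  - by have := P0 m; rewrite !inE => /negbFE.
(* Here dim K is at least 2c + q + np while |Gamma| = np + 1, which matches the upper bound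
   [le1]. *)
have := leq_trans (dim_K_ge good) (dirkerD_le _ _ _); rewrite -cG.
by move: le1; lia.
Qed.

End Decomposed.

Unset Implicit Arguments.

Theorem theorem2p3 (R : realType) (T : finType) (e : rel T)
    (e_sym : symmetric e) (e_irr : irreflexive e) (e_conn : connected e)
    (c_ge1 : (1 <= cyclomatic e)%N)
    (cq_ge3 : (3 <= cyclomatic e + num_quasi_pendant e)%N)
    (lam : R) (lam_neq1 : lam <> 1)
    (g h : 'I_(cyclomatic e) -> nat)
    (k l : 'I_(num_quasi_pendant e) -> nat)
    (t : 'I_(#|Gamma e| - 1) -> nat)
    (f : CG g h + TG k l + PG t -> T)
    (u w : 'I_(#|Gamma e| - 1) -> T)
    (dec : decomposition f u w) :
  optimal e lam <->
  [/\ forall m : 'I_(cyclomatic e),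
        [/\ mult (laplacian R (@cycle_adj (g m))) lam = 2%N,
            (2 < h m)%N
          & forall v : 'I_(h m), pendant (@path_adj (h m)) v ->
              mult (laplacian_del R (@path_adj (h m)) [set v]) lam = 1%N],
      forall i : 'I_(num_quasi_pendant e), mult (Bmx R (k i) (l i)) lam = 1%N
    & forall j : 'I_(#|Gamma e| - 1), mult (Umx R (t j)) lam = 1%N].
Proof.
have exC m : exists x, x \in Gamma e /\
    forall (i : 'I_(g m + h m - 1)) y, y \notin codom (@C_piece _ _ _ _ _ _ _ f m) ->
    e (C_piece f i) y = (i.+1 == g m + h m - 1)%N && (y == x).
  by have [x xG xE] := dec_C_joined dec m; exists x.
have exT i : exists x, x \in Gamma e /\
    forall (a : 'I_(k i + l i)) y, y \notin codom (@T_piece _ _ _ _ _ _ _ f i) ->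
    e (T_piece f a) y = (a.+1 == k i + l i)%N && (y == x).
  by have [x xG xE] := dec_T_joined dec i; exists x.
have [wC wCP] := choice exC; have [wT wTP] := choice exT.
have lam1 : lam != 1 by apply/eqP.
have one (b : bool) : b = 1%N :> nat <-> b by case: b.
rewrite /optimal mult_laplacian //.
rewrite (dim_eigenspace_good e_sym e_conn lam1 dec (fun m => (wCP m).1)
  (fun i => (wTP i).1) (fun m => (wCP m).2) (fun i => (wTP i).2) c_ge1).
split=> [good|[HC HT HP] [[[m b]|i]|j]] /=.
- split=> [m|i|j].
  + have gm : lasso_good lam (g m) (h m) := good (inl (inl (m, true))).
    split; last by move=> v /(mult_path_del lam) ->; apply/one; case/andP: gm.
      by apply/mult_cycle_eq2; [case: (dec_C_param dec m) | case/andP: gm].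
    exact: lasso_good_gt2 gm.
  + have [k0 l0] := dec_T_param dec i.
    by rewrite mult_Bmx //; apply/one; exact: good (inl (inr i)).
  + by rewrite mult_Umx; apply/one; exact: good (inr j).
- have [cyc h2 path] := HC m; have [g3 _] := dec_C_param dec m.
  apply/andP; split; first exact/mult_cycle_eq2.
  have h0 : (0 < h m)%N by apply: leq_trans h2.
  (* The bound 2 < h provides an end vertex to which the path condition applies. *)
  have v0 : pendant (@path_adj (h m)) (Ordinal h0) by rewrite path_pendant /= ltnW.
  by apply/one; rewrite -(mult_path_del lam v0) path.
- have [k0 l0] := dec_T_param dec i.
  by apply/one; rewrite -[RHS](HT i) mult_Bmx.
- by apply/one; rewrite -[RHS](HP j) mult_Umx.
Qed.
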